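(* Let $k$ be a field of characteristic zero and $R=k[x,y,z]$ the standard graded polynomial ring. Let $$L_1=a_1x+a_2y+a_3z,\quad L_2=a_4x+a_5y+a_6z,\quad L_3=a_7x+a_8y+a_9z\qquad(a_i\in k)$$ be linear forms such that at least one of the quadrics $Q_1=xL_2-yL_1$, $Q_2=xL_3-zL_1$, $Q_3=yL_3-zL_2$ is non-zero, let $\Theta$ be the $3\times3$ Jacobian matrix of $Q_1,Q_2,Q_3$ with respect to $x,y,z$, and suppose that the cubic $f:=\det\Theta$ is non-zero and reduced. The following assertions hold: (i) $J_f$ is of linear type. In particular, ${\rm r}(J_f)=0$; (ii) $\mathscr{R}(J_f)$ $(\cong{\rm Sym}_RJ_f)$ is a complete intersection; (iii) ${\rm reg}\,{\rm Der}_k(R/(f))=1$.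
   Context: The columns of $\Theta$ are the gradients of $Q_1,Q_2,Q_3$. $J_f=(f_x,f_y,f_z)\subset R$ is the Jacobian ideal of $f$. Standing convention: $f$ has $k$-linearly independent partial derivatives. For a homogeneous proper ideal $I\subset R$, $\mathscr{R}(I)=\bigoplus_{i\ge0}I^it^i\subset R[t]$ is the Rees algebra; $I$ is of linear type if the natural epimorphism ${\rm Sym}_RI\to\mathscr{R}(I)$ is an isomorphism. A subideal $K\subset I$ is a reduction of $I$ if $I^{r+1}=KI^r$ for some $r\ge0$, ${\rm r}_K(I)$ is the least such $r$, and the reduction number ${\rm r}(I)$ is the minimum of ${\rm r}_K(I)$ over all reductions $K$ of $I$ minimal with respect to inclusion. Complete intersection means a quotient of a polynomial ring over $R$ by an ideal generated by a regular sequence. ${\rm Der}_k(R)$ is graded so that each partial derivation has degree $-1$; $T_{R/k}(f)=\{\theta\in{\rm Der}_k(R):\theta(f)\in(f)\}$ has the induced grading, and ${\rm Der}_k(R/(f))=T_{R/k}(f)/f{\rm Der}_k(R)$ the quotient grading. For a finitely generated graded $R$-module $E$ with minimal graded free resolution with terms $F_i=\bigoplus_jR(-a_{i,j})$, the Castelnuovo-Mumford regularity is ${\rm reg}\,E=\max\{a_{i,j}-i\}$. *)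

(* Defs.v *)
From HB Require Import structures.
From mathcomp Require Import all_boot all_algebra.
From mathcomp Require Import finmap boolp.
From mathcomp Require Import monalg.

Set Implicit Arguments.
Unset Strict Implicit.
Unset Printing Implicit Defensive.

Import GRing.Theory.

Local Open Scope ring_scope.
Local Open Scope quotient_scope.

Record submod (A : comNzRingType) (V : lmodType A) := Submod {
  submod_carrier :> V -> Prop;
  submod0 : submod_carrier 0;
  submodD : forall u v,
    submod_carrier u -> submod_carrier v -> submod_carrier (u + v);
  submodZ : forall a v, submod_carrier v -> submod_carrier (a *: v) }.

Section Submodules.
Variables (A : comNzRingType) (V : lmodType A).
Implicit Types N : submod V.

Definition submod_pred N : {pred V} := fun v => `[< N v >].

Lemma submod_predE N v : (v \in submod_pred N) = `[< N v >].
Proof. by []. Qed.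

Lemma submod_pred_closed N : submod_closed (submod_pred N).
Proof.
split; first exact/asboolP/submod0.
by move=> a u v /asboolP Nu /asboolP Nv; apply/asboolP/submodD => //; apply: submodZ.
Qed.

HB.instance Definition _ N :=
  GRing.isSubmodClosed.Build A V (submod_pred N) (submod_pred_closed N).

Record sub_lmod N :=
  SubLmod { sub_lmod_val :> V; _ : sub_lmod_val \in submod_pred N }.

HB.instance Definition _ N := [isSub for @sub_lmod_val N].
HB.instance Definition _ N := [Choice of sub_lmod N by <:].
HB.instance Definition _ N := [SubChoice_isSubLmodule of sub_lmod N by <:].

Lemma sub_lmodP N (u : sub_lmod N) : N (val u).
Proof. exact/asboolP/(valP u). Qed.

Definition quot_lmod N : Type := @Quotient.quot V (submod_pred N).

HB.instance Definition _ N := GRing.Zmodule.on (quot_lmod N).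
HB.instance Definition _ N := EqQuotient.on (quot_lmod N).

Definition quot_scale N (a : A) (x : quot_lmod N) : quot_lmod N :=
  \pi_(quot_lmod N) (a *: repr x).

Lemma quot_lmodP N (u v : V) :
  reflect (N (u - v)) (\pi_(quot_lmod N) u == \pi_(quot_lmod N) v).
Proof. by rewrite -[_ == _]Quotient.idealrBE; apply: asboolP. Qed.

Lemma quot_scale_pi N a v :
  quot_scale a (\pi_(quot_lmod N) v) = \pi_(quot_lmod N) (a *: v).
Proof.
apply/eqP/quot_lmodP; rewrite -scalerBr; apply: submodZ.
by apply/quot_lmodP; rewrite reprK.
Qed.

Lemma quot_piD N u v :
  \pi_(quot_lmod N) (u + v) = \pi_(quot_lmod N) u + \pi_(quot_lmod N) v.
Proof. exact: (@Quotient.pi_add V (submod_pred N) u v). Qed.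

Fact quot_scaleA N (a b : A) (x : quot_lmod N) :
  quot_scale a (quot_scale b x) = quot_scale (a * b) x.
Proof. by elim/quotW: x => v; rewrite (quot_scale_pi _ b) !quot_scale_pi scalerA. Qed.

Fact quot_scale1 N : left_id 1 (@quot_scale N).
Proof. by elim/quotW => v; rewrite quot_scale_pi scale1r. Qed.

Fact quot_scaleDr N : right_distributive (@quot_scale N) +%R.
Proof.
move=> a; elim/quotW => u; elim/quotW => v.
by rewrite -quot_piD !quot_scale_pi scalerDr quot_piD.
Qed.

Fact quot_scaleDl N (x : quot_lmod N) :
  {morph (@quot_scale N)^~ x : a b / a + b}.
Proof.
by move=> a b; elim/quotW: x => v; rewrite !quot_scale_pi scalerDl quot_piD.
Qed.

HB.instance Definition _ N := GRing.Zmodule_isLmodule.Build A (quot_lmod N)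
  (@quot_scaleA N) (@quot_scale1 N) (@quot_scaleDr N) (@quot_scaleDl N).

Definition span (S : V -> Prop) : submod V.
Proof.
exists (fun v => forall N, (forall s, S s -> N s) -> N v).
- by move=> N _; apply: submod0.
- by move=> u v Hu Hv N SN; apply: submodD; [apply: Hu | apply: Hv].
- by move=> a v Hv N SN; apply: submodZ; apply: Hv.
Defined.

Lemma mem_span (S : V -> Prop) v : S v -> span S v.
Proof. by move=> Sv N; apply. Qed.

End Submodules.

Definition ideal (A : comNzRingType) := @submod A A^o.

Section Ideals.
Variable A : comNzRingType.
Implicit Types I J K : ideal A.

Definition ideal_of (S : A -> Prop) : ideal A := @span A A^o S.

Lemma idealMl I (a x : A) : I x -> I (a * x).
Proof. exact: (@submodZ _ _ I a x). Qed.

Definition ideal_incl I J := forall x, I x -> J x.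
Definition ideal_eq I J := forall x, I x <-> J x.

Definition ideal_mul I J : ideal A :=
  ideal_of (fun x => exists2 a, I a & exists2 b, J b & x = a * b).

Fixpoint ideal_exp I n : ideal A :=
  if n is m.+1 then ideal_mul I (ideal_exp I m) else ideal_of (fun x => x = 1).

Definition reduces_at K I r :=
  ideal_eq (ideal_exp I r.+1) (ideal_mul K (ideal_exp I r)).

Definition reduction K I := ideal_incl K I /\ exists r, reduces_at K I r.

Definition minimal_reduction K I :=
  reduction K I /\
  forall K', reduction K' I -> ideal_incl K' K -> ideal_eq K' K.

Definition is_rel_reduction_number K I r :=
  reduces_at K I r /\ forall s, reduces_at K I s -> (r <= s)%N.

Definition is_reduction_number I r :=
  (exists2 K, minimal_reduction K I & is_rel_reduction_number K I r) /\
  forall K s, minimal_reduction K I -> is_rel_reduction_number K I s ->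
    (r <= s)%N.

Lemma ideal_exp0 I x : ideal_exp I 0 x.
Proof.
rewrite -[x]mulr1; apply: (idealMl (I := ideal_exp I 0)).
exact: (@mem_span A A^o).
Qed.

Lemma ideal_expD I m n a b :
  ideal_exp I m a -> ideal_exp I n b -> ideal_exp I (m + n) (a * b).
Proof.
elim: m a => [|m IHm] a Ha Hb; first exact: idealMl.
have N0 : ideal_exp I (m.+1 + n) (0 * b) by rewrite mul0r; apply: submod0.
have ND u v : ideal_exp I (m.+1 + n) (u * b) -> ideal_exp I (m.+1 + n) (v * b) ->
  ideal_exp I (m.+1 + n) ((u + v) * b) by rewrite mulrDl; apply: submodD.
have NZ c v : ideal_exp I (m.+1 + n) (v * b) ->
  ideal_exp I (m.+1 + n) ((c * v) * b) by rewrite -mulrA; apply: submodZ.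
apply: (Ha (@Submod A A^o (fun x => ideal_exp I (m.+1 + n) (x * b)) N0 ND NZ)).
move=> _ [c Ic [d Id ->]] /=; apply: (@mem_span A A^o).
by exists c => //; exists (d * b); [exact: IHm | rewrite mulrA].
Qed.

End Ideals.

(* The subalgebra of A[t] of the p whose coefficient of t^i lies in I^i. *)
Section Rees.
Variables (A : comNzRingType) (I : ideal A).

Definition rees_pred : {pred {poly A}} :=
  fun p => `[< forall i, ideal_exp I i p`_i >].

Lemma rees_pred_closed : subalg_closed rees_pred.
Proof.
split.
- apply/asboolP => i; rewrite coef1; case: i => [|i]; first exact: ideal_exp0.
  exact: submod0.
- move=> a p q /asboolP Hp /asboolP Hq; apply/asboolP => i.
  by rewrite coefD coefZ; apply: submodD => //; apply: (idealMl a (Hp i)).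
- move=> p q /asboolP Hp /asboolP Hq; apply/asboolP => i.
  rewrite coefM; elim/big_ind: _ => [|u v|j _]; first exact: submod0.
    exact: (@submodD A A^o (ideal_exp I i)).
  by rewrite -{1}(subnKC (ltn_ord j : j <= i)%N); apply: ideal_expD.
Qed.

HB.instance Definition _ :=
  GRing.isSubalgClosed.Build A {poly A} rees_pred rees_pred_closed.

Record Rees := ReesElt { rees_val :> {poly A}; _ : rees_val \in rees_pred }.

HB.instance Definition _ := [isSub for rees_val].
HB.instance Definition _ := [Choice of Rees by <:].
HB.instance Definition _ := [SubChoice_isSubAlgebra of Rees by <:].
HB.instance Definition _ := [SubNzRing_isSubComNzRing of Rees by <:].

End Rees.

(* Locked: otherwise unifying two variables unfolds finitely supported functions. *)
HB.lock Definition sym_var (A : comNzRingType) (M : lmodType A) (m : M) :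
  {malg A[{cmonom M}]} := << 1 *g ucm m >>.

Section SymmetricAlgebra.
Variables (A : comNzRingType) (M : lmodType A).

Local Notation sym_poly := {malg A[{cmonom M}]}.

Definition sym_relation (p : sym_poly) : Prop :=
  (exists m1 m2, p = sym_var (m1 + m2) - (sym_var m1 + sym_var m2)) \/
  (exists a m, p = sym_var (a *: m) - a *: sym_var m).

Definition sym_ideal : ideal sym_poly := ideal_of sym_relation.

Definition sym_pred : {pred sym_poly} := fun p => `[< sym_ideal p >].

Definition sym_coef0 (p : sym_poly) : A := mcoeff (mone : {cmonom M}) p.

Lemma sym_coef0_var m : sym_coef0 (sym_var m) = 0.
Proof.
rewrite sym_var.unlock [LHS]mcoeffU; case: eqP => // /eqP/cmP/(_ m).
by rewrite ucmE eqxx cm1.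
Qed.

Lemma sym_coef0B p q : sym_coef0 (p - q) = sym_coef0 p - sym_coef0 q.
Proof. exact: mcoeffB. Qed.

Lemma sym_coef0D p q : sym_coef0 (p + q) = sym_coef0 p + sym_coef0 q.
Proof. exact: mcoeffD. Qed.

Lemma sym_coef0Z a p : sym_coef0 (a *: p) = a * sym_coef0 p.
Proof. exact: mcoeffZ. Qed.

Lemma sym_coef0M p q : sym_coef0 (p * q) = sym_coef0 p * sym_coef0 q.
Proof. exact: (rmorphM (mcoeff mone : {malg A[{cmonom M}]} -> A)). Qed.

Lemma sym_relation_coef0 p : sym_relation p -> sym_coef0 p = 0.
Proof.
case=> [[m1 [m2 ->]]|[a [m ->]]].
- by rewrite sym_coef0B sym_coef0D !sym_coef0_var addr0 subr0.
- by rewrite sym_coef0B sym_coef0Z !sym_coef0_var mulr0 subr0.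
Qed.

Lemma sym_ideal_coef0 p : sym_ideal p -> sym_coef0 p = 0.
Proof.
have N0 : sym_coef0 0 = 0 by rewrite -(subrr 0) sym_coef0B subrr.
have ND u v : sym_coef0 u = 0 -> sym_coef0 v = 0 -> sym_coef0 (u + v) = 0.
  by rewrite sym_coef0D => -> ->; rewrite addr0.
have NZ a v : sym_coef0 v = 0 -> sym_coef0 (a * v) = 0.
  by rewrite sym_coef0M => ->; rewrite mulr0.
move=> /(_ (@Submod _ sym_poly^o _ N0 ND NZ)); apply => s; exact: sym_relation_coef0.
Qed.

Lemma sym_pred_closed : idealr_closed sym_pred.
Proof.
split.
- exact/asboolP/(@submod0 _ _ sym_ideal).
- apply/asboolP => /sym_ideal_coef0/eqP.
  by rewrite [sym_coef0 1]mcoeff1 eqxx oner_eq0.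
- move=> a u v /asboolP Iu /asboolP Iv; apply/asboolP.
  by apply: (@submodD _ _ sym_ideal) => //; apply: idealMl.
Qed.

HB.instance Definition _ := isIdealr.Build sym_poly sym_pred sym_pred_closed.

(* A[X_m : m in M] modulo the relations making m |-> X_m A-linear. *)
Definition Sym : comNzRingType := {ideal_quot sym_pred}.

Definition sym_pi (p : sym_poly) : Sym := \pi_(Sym) p.

End SymmetricAlgebra.

Section SymmetricLift.
Variables (A : comNzRingType) (M : lmodType A) (B : comAlgType A).
Variable phi : M -> B.

Local Notation sym_poly := {malg A[{cmonom M}]}.

Definition sym_monom (mon : {cmonom M}) : B :=
  \prod_(m <- finsupp (cmonom_val mon)) phi m ^+ mon m.

(* The A-algebra map A[X_m : m in M] -> B sending X_m to phi m, and the map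
   Sym M -> B that it induces when phi is linear (see sym_lift_pi). *)
Definition sym_eval (p : sym_poly) : B := mmap (in_alg B) sym_monom p.
Definition sym_lift (s : Sym M) : B := sym_eval (repr s).

Lemma sym_monom1 : sym_monom mone = 1.
Proof. by rewrite /sym_monom mdom1 big_seq_fset0. Qed.

Lemma sym_monomE (d : {fset M}) mon : (finsupp (cmonom_val mon) `<=` d)%fset ->
  sym_monom mon = \prod_(m <- d) phi m ^+ mon m.
Proof.
move=> le; apply: big_fset_incl => // m _.
by rewrite -cmE_eq0 => /eqP ->; rewrite expr0.
Qed.

Lemma sym_monomM : {morph sym_monom : m1 m2 / mmul m1 m2 >-> m1 * m2}.
Proof.
move=> m1 m2.
rewrite (sym_monomE (mon := m1) (fsubsetUl _ (finsupp (cmonom_val m2)))).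
rewrite (sym_monomE (mon := m2) (fsubsetUr (finsupp (cmonom_val m1)) _)).
rewrite -big_split /sym_monom; rewrite (mdomD m1 m2 : finsupp _ = _) /=.
by apply: eq_bigr => m _; rewrite cmM exprD.
Qed.

Lemma sym_monomU m : sym_monom (ucm m) = phi m.
Proof. by rewrite /sym_monom mdomU big_seq_fset1 cmUU expr1. Qed.

Lemma sym_eval_var m : sym_eval (sym_var m) = phi m.
Proof. by rewrite sym_var.unlock /sym_eval mmapU sym_monomU /= scale1r mul1r. Qed.

Lemma sym_evalB p q : sym_eval (p - q) = sym_eval p - sym_eval q.
Proof. exact: raddfB. Qed.

Lemma sym_eval0 : sym_eval 0 = 0.
Proof. exact: raddf0. Qed.

Lemma sym_evalD p q : sym_eval (p + q) = sym_eval p + sym_eval q.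
Proof. exact: raddfD. Qed.

Lemma sym_evalZ a p : sym_eval (a *: p) = a *: sym_eval p.
Proof.
rewrite /sym_eval (mmapEw (msuppZ_le a p)) mmapE scaler_sumr.
by apply: eq_bigr => mon _; rewrite mcoeffZ /= -scalerA scalerAl.
Qed.

Lemma sym_evalM p q : sym_eval (p * q) = sym_eval p * sym_eval q.
Proof.
rewrite malgME /sym_eval raddf_sum mulr_suml; apply: eq_bigr => m1 _.
rewrite raddf_sum mulr_sumr; apply: eq_bigr => m2 _.
by rewrite /= mmapU sym_monomM /= -scalerA -!scalerAl !mul1r -scalerAr.
Qed.

Lemma sym_lift_pi : linear phi ->
  forall p, sym_lift (sym_pi p) = sym_eval p.
Proof.
move=> phi_lin p.
have phiD u v : phi (u + v) = phi u + phi v.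
  by have := phi_lin 1 u v; rewrite !scale1r.
have phi0 : phi 0 = 0 by apply: (addrI (phi 0)); rewrite -phiD !addr0.
have phiZ a u : phi (a *: u) = a *: phi u.
  by have := phi_lin a u 0; rewrite phi0 !addr0.
have ND u v : sym_eval u = 0 -> sym_eval v = 0 -> sym_eval (u + v) = 0.
  by rewrite sym_evalD => -> ->; rewrite addr0.
have NZ a v : sym_eval v = 0 -> sym_eval (a * v) = 0.
  by rewrite sym_evalM => ->; rewrite mulr0.
apply/eqP; rewrite -subr_eq0 -sym_evalB; apply/eqP.
have /asboolP: repr (sym_pi p) - p \in @sym_pred A M.
  by rewrite Quotient.idealrBE reprK.
move=> /(_ (@Submod _ sym_poly^o _ sym_eval0 ND NZ)); apply => q /= [].
  by move=> [m1 [m2 ->]]; rewrite sym_evalB sym_evalD !sym_eval_var phiD subrr.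
by move=> [a [m ->]]; rewrite sym_evalB sym_evalZ !sym_eval_var phiZ subrr.
Qed.

End SymmetricLift.

Section LinearType.
Variables (A : comNzRingType) (I : ideal A).

Fact rees_degree1_subproof (a : sub_lmod I) : (val a : A) *: 'X \in rees_pred I.
Proof.
apply/asboolP => -[|[|i]]; rewrite coefZ coefX ?mulr0.
- exact: submod0.
- rewrite mulr1; apply: (@mem_span A A^o); exists (val a); first exact: sub_lmodP.
  by exists 1; rewrite ?mulr1 //; apply: ideal_exp0.
- exact: submod0.
Qed.

Definition rees_degree1 (a : sub_lmod I) : Rees I :=
  ReesElt (rees_degree1_subproof a).

Lemma rees_degree1_linear : linear rees_degree1.
Proof. by move=> a u v; apply: val_inj; rewrite /= scalerDl -scalerA. Qed.

(* The natural epimorphism, sending the class of X_a to a t. *)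
Definition sym_to_rees : Sym (sub_lmod I) -> Rees I := sym_lift rees_degree1.

Definition linear_type : Prop := bijective sym_to_rees.

End LinearType.

(* Imported only here because mpoly shadows names of monalg (mcoeff, mmap). *)
From mathcomp Require Import mpoly.

Definition regular_seq (A : comNzRingType) (s : seq A) : Prop :=
  ~ ideal_of (fun x => x \in s) 1 /\
  forall i x, (i < size s)%N ->
    ideal_of (fun y => y \in take i s) (s`_i * x) ->
    ideal_of (fun y => y \in take i s) x.

Definition complete_intersection (A : comNzRingType) (B : comAlgType A) : Prop :=
  exists n (s : seq {mpoly A[n]}) (phi : {lrmorphism {mpoly A[n]} -> B}),
    [/\ regular_seq s,
        forall b, exists p, phi p = b &
        forall p, phi p = 0 <-> ideal_of (fun q => q \in s) p].

Record derivation (k : comNzRingType) (A : comAlgType k) := Derivation {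
  der_fun :> A -> A;
  der_linear : linear der_fun;
  der_leibniz : forall a b, der_fun (a * b) = a * der_fun b + b * der_fun a }.

Section Derivations.
Variables (k : comNzRingType) (A : comAlgType k).
Local Notation Der := (derivation A).
Implicit Types theta eta : Der.

HB.instance Definition _ := gen_eqMixin Der.
HB.instance Definition _ := gen_choiceMixin Der.

Lemma derP theta eta : theta =1 eta -> theta = eta.
Proof.
case: theta => t tL tM; case: eta => e eL eM /= /funext te.
by case: e / te eL eM => eL eM; congr Derivation; apply: Prop_irrelevance.
Qed.

Definition der_zero : Der.
Proof.
by exists (fun=> 0) => [a u v|a b]; rewrite ?scaler0 ?mulr0 addr0.
Defined.

Definition der_add theta eta : Der.
Proof.
exists (fun a => theta a + eta a) => [c u v|a b].
- by rewrite !der_linear scalerDr addrACA.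
- by rewrite !der_leibniz !mulrDr addrACA.
Defined.

Definition der_scale (c : A) theta : Der.
Proof.
exists (fun a => c * theta a) => [d u v|a b].
- by rewrite der_linear mulrDr scalerAr.
- by rewrite der_leibniz mulrDr !(mulrCA c).
Defined.

Fact der_addA : associative der_add.
Proof. by move=> t1 t2 t3; apply: derP => a /=; rewrite addrA. Qed.
Fact der_addC : commutative der_add.
Proof. by move=> t1 t2; apply: derP => a /=; rewrite addrC. Qed.
Fact der_add0 : left_id der_zero der_add.
Proof. by move=> t; apply: derP => a /=; rewrite add0r. Qed.
Fact der_addN : left_inverse der_zero (der_scale (-1)) der_add.
Proof. by move=> t; apply: derP => a /=; rewrite mulN1r addNr. Qed.

HB.instance Definition _ :=
  GRing.isZmodule.Build Der der_addA der_addC der_add0 der_addN.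

Fact der_scaleA a b theta :
  der_scale a (der_scale b theta) = der_scale (a * b) theta.
Proof. by apply: derP => x /=; rewrite mulrA. Qed.
Fact der_scale0 theta : der_scale 0 theta = 0.
Proof. by apply: derP => x /=; rewrite mul0r. Qed.
Fact der_scale1 : left_id 1 der_scale.
Proof. by move=> t; apply: derP => x /=; rewrite mul1r. Qed.
Fact der_scaleDr : right_distributive der_scale +%R.
Proof. by move=> a t1 t2; apply: derP => x /=; rewrite mulrDr. Qed.
Fact der_scaleDl theta : {morph der_scale^~ theta : a b / a + b}.
Proof. by move=> a b; apply: derP => x /=; rewrite mulrDl. Qed.

HB.instance Definition _ := GRing.Nmodule_isLSemiModule.Build A Der
  der_scaleA der_scale0 der_scale1 der_scaleDr der_scaleDl.

Lemma der_addE theta eta a : (theta + eta) a = theta a + eta a.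
Proof. by []. Qed.
Lemma der_scaleE c theta a : (c *: theta) a = c * theta a.
Proof. by []. Qed.

Variable f : A.

Definition principal : ideal A := ideal_of (fun x => x = f).

(* T_{A/k}(f) *)
Definition tder : submod Der.
Proof.
exists (fun theta => principal (theta f)).
- exact: (@submod0 _ _ principal).
- move=> t1 t2; rewrite der_addE; exact: (@submodD _ _ principal).
- move=> c t; rewrite der_scaleE; exact: (@submodZ _ _ principal).
Defined.

(* f Der_k(A), as a submodule of T_{A/k}(f) *)
Definition fder : submod (sub_lmod tder).
Proof.
exists (fun u : sub_lmod tder => exists eta : Der, val u = f *: eta).
- by exists 0; rewrite scaler0.
- by move=> t1 t2 [e1 E1] [e2 E2]; exists (e1 + e2); rewrite scalerDr -E1 -E2.
- move=> c t [e E]; exists (c *: e).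
  by rewrite linearZ /= E !scalerA mulrC.
Defined.

(* Der_k(A/(f)) = T_{A/k}(f) / f Der_k(A) *)
Definition der_quotient : lmodType A := quot_lmod fder.

End Derivations.

Section Graded.
Variables (k : fieldType) (n : nat).
Local Notation R := {mpoly k[n]}.

(* For d < 0 the homogeneous component of degree d of R is zero. *)
Definition homogz (d : int) (p : R) : Prop :=
  if d is Posz m then p \is m.-homog else p = 0.

Definition partial (i : 'I_n) : derivation R.
Proof.
exists (fun p => p^`M(i)) => [c u v|a b].
- by rewrite mderivD mderivZ.
- by rewrite mderivM addrC [in X in _ + X]mulrC.
Defined.

(* Each partial derivation has degree -1, so that sum_i g_i d/dx_i has degree
   d when the g_i are homogeneous of degree d + 1. *)
Definition der_homog (d : int) (theta : derivation R) : Prop :=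
  exists2 g : 'I_n -> R,
    forall i, homogz (d + 1) (g i) & theta = \sum_(i < n) g i *: partial i.

Definition der_quotient_homog (f : R) (d : int) (e : der_quotient f) : Prop :=
  exists2 theta : sub_lmod (tder f),
    der_homog d (val theta) & e = \pi_(quot_lmod (fder f)) theta.

(* gr d is the homogeneous component of degree d of E. The i-th free module is
   \bigoplus_j R(- gres_shift i j), of rank gres_rank i; the differentials act
   on row vectors on the right. Minimality says that their (homogeneous) entries
   lie in the irrelevant ideal, i.e. have no constant term. *)
Record min_graded_res (E : lmodType R) (gr : int -> E -> Prop) := MinGradedRes {
  gres_rank : nat -> nat;
  gres_shift : forall i, 'I_(gres_rank i) -> int;
  gres_map : forall i, 'M[R]_(gres_rank i.+1, gres_rank i);
  gres_aug : 'I_(gres_rank 0) -> E;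
  _ : forall j, gr (gres_shift j) (gres_aug j);
  _ : forall i r c,
        homogz (@gres_shift i.+1 r - @gres_shift i c) (gres_map i r c);
  _ : forall e, exists v : 'rV_(gres_rank 0), e = \sum_j v 0 j *: gres_aug j;
  _ : forall v : 'rV_(gres_rank 0),
        \sum_j v 0 j *: gres_aug j = 0 <-> exists w, v = w *m gres_map 0;
  _ : forall i (v : 'rV_(gres_rank i.+1)),
        v *m gres_map i = 0 <-> exists w, v = w *m gres_map i.+1;
  _ : forall i r c, (gres_map i r c)@_0%MM = 0 }.

(* Minimal resolutions being unique up to isomorphism, one of them suffices. *)
Definition is_regularity (E : lmodType R) (gr : int -> E -> Prop) (r : int) :=
  exists F : min_graded_res gr,
    (exists i j, @gres_shift _ _ F i j - i%:Z = r) /\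
    forall i j, (@gres_shift _ _ F i j - i%:Z <= r)%R.

Definition jacobian_ideal (f : R) : ideal R :=
  ideal_of (fun p => exists i, p = f^`M(i)).

(* R/(f) is a reduced ring. *)
Definition reduced (f : R) : Prop :=
  forall g m, principal f (g ^+ m) -> principal f g.

(* The partial derivatives of f are k-linearly independent. *)
Definition partials_free (f : R) : Prop :=
  forall c : 'I_n -> k, \sum_i c i *: f^`M(i) = 0 -> forall i, c i = 0.

End Graded.

(* Main.v *)
Require Import Defs.
From HB Require Import structures.
From mathcomp Require Import all_boot all_algebra all_field.
From mathcomp Require Import boolp zify ring.
From mathcomp Require finmap monalg perm.
From mathcomp Require Import ssrcomplements mpoly.

(** Let v be the column (x, y, z) and C the matrix of the a_i, so that C v is the
    column (L1, L2, L3). Up to the factor -2, the cubic f is the determinant of the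
    matrix S with columns v, C v and C^2 v ([jacobian_det_minors]). This
    determinant can be reduced only if the characteristic polynomial of C is
    separable: for a double eigenvalue a there are rows w and u with w (C - a) = 0 and
    u (C - a) = w, and the square of the linear form w v divides f
    ([krylov_double_eigenvalue], [reduced_separable]). Therefore, over a splitting
    field L of the characteristic polynomial, C becomes diagonal in suitable linear
    coordinates x0, x1, x2, and there f is a multiple of x0 x1 x2.

    For x0 x1 x2 the Rees algebra of the Jacobian ideal is a semigroup ring. The map
    T_i |-> (d/dx_i) (x0 x1 x2) t sends monomials to monomials, and a normal form for
    monomials shows that its kernel is generated by x0 T0 - x1 T1 and
    x1 T1 - x2 T2 ([toric_kernel]), which form a regular sequence ([toric_syzygy]).
    These binomials span the forms sum_j d_j x_j T_j with d_0 + d_1 + d_2 = 0. The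
    same pencil is spanned over L by two forms l1 and l2 with coefficients in k, given
    by the traceless parts of C and C^2. As k -> L has a k-linear retraction, which
    extends to polynomial rings, what was proved over L holds over k
    ([krylov_cubic_facts]): the kernel of R[T0, T1, T2] -> R[t] is
    generated by the regular sequence l1, l2.

    Since l1 and l2 are linear in the T_i, the ideal is of linear type
    ([relations_linear_linear_type]) and has no proper reduction
    ([relations_linear_no_reduction]), so its reduction number is 0; and the Rees
    algebra is a complete intersection ([krylov_complete_intersection]).

    The part of degree 1 in the T_i of the same statement says that the syzygies of
    the partial derivatives are generated by the traceless parts of the fields C v and
    C^2 v. Together with the Euler field v this makes v, C v, C^2 v a basis of the
    module of derivations preserving (f) ([tder_lin_generated]). Expressing
    the f d/dx_i in this basis uses the adjugate of S, and gives the resolution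
    0 -> R(-2)^3 -> R^3 of Der (R/(f)), whose regularity is 2 - 1 = 1
    ([krylov_regularity]). *)

Set Implicit Arguments.
Unset Strict Implicit.
Unset Printing Implicit Defensive.

Import GRing.Theory.
Local Open Scope ring_scope.

(** * Ideals given by generators *)

Section IdealTheory.
Variable A : comNzRingType.
Implicit Types (I : ideal A) (S : A -> Prop).

Lemma ideal_of_sub S I (x : A) : (forall s, S s -> I s) -> ideal_of S x -> I x.
Proof. by move=> SI; apply. Qed.

Lemma ideal0 I : I (0 : A).
Proof. exact: (@submod0 A A^o I). Qed.

Lemma idealD I (x y : A) : I x -> I y -> I (x + y).
Proof. exact: (@submodD A A^o I). Qed.

Lemma idealN I (x : A) : I x -> I (- x).
Proof. by rewrite -mulN1r; apply: idealMl. Qed.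

Lemma idealB I (x y : A) : I x -> I y -> I (x - y).
Proof. by move=> Ix Iy; apply/idealD/idealN. Qed.

Lemma ideal_mulr I (a x : A) : I x -> I (x * a).
Proof. by rewrite mulrC; apply: idealMl. Qed.

Lemma ideal_sum (T : Type) (r : seq T) (P : pred T) (F : T -> A) I :
  (forall i, P i -> I (F i)) -> I (\sum_(i <- r | P i) F i).
Proof. by move=> IF; apply: (big_ind I) => //; [exact: ideal0|exact: idealD]. Qed.

Lemma ideal_of_mem S (x : A) : S x -> ideal_of S x.
Proof. exact: (@mem_span A A^o). Qed.

Lemma ideal_of2P (a b p : A) :
  ideal_of (fun q => q \in [:: a; b]) p <-> exists u v, p = u * a + v * b.
Proof.
split=> [|[u [v ->]]]; last first.
  by apply: idealD; apply: idealMl; apply: ideal_of_mem; rewrite !inE eqxx ?orbT.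
have N0 : exists u v, 0 = u * a + v * b by exists 0, 0; rewrite !mul0r addr0.
have ND x y : (exists u v, x = u * a + v * b) ->
  (exists u v, y = u * a + v * b) -> exists u v, x + y = u * a + v * b.
  move=> [u [v ->]] [u' [v' ->]]; exists (u + u'), (v + v').
  by rewrite !mulrDl addrACA.
have NZ c x : (exists u v, x = u * a + v * b) ->
  exists u v, c * x = u * a + v * b.
  by move=> [u [v ->]]; exists (c * u), (c * v); rewrite mulrDr !mulrA.
apply: (@ideal_of_sub _ (@Submod A A^o _ N0 ND NZ)) => s /=.
rewrite !inE => /orP[]/eqP->; first by exists 1, 0; rewrite mul1r mul0r addr0.
by exists 0, 1; rewrite mul1r mul0r add0r.
Qed.

Lemma ideal_of1P (a p : A) :
  ideal_of (fun q => q \in [:: a]) p <-> exists u, p = u * a.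
Proof.
split=> [|[u ->]]; last by apply/idealMl/ideal_of_mem; rewrite inE.
have N0 : exists u, 0 = u * a by exists 0; rewrite mul0r.
have ND x y : (exists u, x = u * a) -> (exists u, y = u * a) ->
  exists u, x + y = u * a.
  by move=> [u ->] [u' ->]; exists (u + u'); rewrite mulrDl.
have NZ c x : (exists u, x = u * a) -> exists u, c * x = u * a.
  by move=> [u ->]; exists (c * u); rewrite mulrA.
apply: (@ideal_of_sub _ (@Submod A A^o _ N0 ND NZ)) => s /=.
by rewrite !inE => /eqP->; exists 1; rewrite mul1r.
Qed.

Lemma ideal_of0 (p : A) : ideal_of (fun q => q \in [::]) p -> p = 0.
Proof.
have ND (x y : A) : x = 0 -> y = 0 -> x + y = 0 by move=> -> ->; rewrite addr0.
have NZ (c x : A) : x = 0 -> c * x = 0 by move=> ->; rewrite mulr0.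
exact: (@ideal_of_sub _ (@Submod A A^o (fun x => x = 0) erefl ND NZ)).
Qed.

Lemma principalP (K : comNzRingType) (B : comAlgType K) (f x : B) :
  principal f x <-> exists u, x = u * f.
Proof.
split=> [|[u ->]]; last first.
  apply: (idealMl (I := principal f)).
  exact: (@mem_span B B^o).
have N0 : exists u, 0 = u * f by exists 0; rewrite mul0r.
have ND y z : (exists u, y = u * f) -> (exists u, z = u * f) ->
  exists u, y + z = u * f.
  by move=> [u ->] [u' ->]; exists (u + u'); rewrite mulrDl.
have NZ c y : (exists u, y = u * f) -> exists u, c * y = u * f.
  by move=> [u ->]; exists (c * u); rewrite mulrA.
move=> /(_ (@Submod B B^o _ N0 ND NZ)); apply => s -> /=.
by exists 1; rewrite mul1r.
Qed.

End IdealTheory.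

(** * Induction on polynomials *)

Lemma mpoly_ring_ind (n : nat) (A : nzRingType) (P : {mpoly A[n]} -> Prop) :
  (forall c, P c%:MP) -> (forall i, P 'X_i) ->
  (forall p q, P p -> P q -> P (p + q)) ->
  (forall p q, P p -> P q -> P (p * q)) -> forall p, P p.
Proof.
move=> PC PX PD PM p; rewrite [p]mpolyE.
have P1 : P 1 by rewrite -mpolyC1.
apply: (big_ind P) => [|u v|m _]; [by rewrite -mpolyC0|exact: PD|].
rewrite -mul_mpolyC; apply: (PM) => //; rewrite mpolyXE_id.
apply: (big_ind P) => [|u v|i _]; [exact: P1|exact: PM|].
by elim: (m i) => [|d IHd]; rewrite ?expr0 // exprS; apply: PM.
Qed.

Lemma mpoly_rmorph_eq (n : nat) (A B : nzRingType)
    (F G : {rmorphism {mpoly A[n]} -> B}) :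
  (forall c, F c%:MP = G c%:MP) -> (forall i, F 'X_i = G 'X_i) -> F =1 G.
Proof.
move=> FC FX; apply: mpoly_ring_ind => // p q.
  by rewrite !rmorphD => -> ->.
by rewrite !rmorphM => -> ->.
Qed.

Lemma mpoly_lreg n (A : idomainType) (p : {mpoly A[n]}) : p != 0 -> GRing.lreg p.
Proof. by move=> p0; apply: lreg_mleadc; apply/lregP; rewrite mleadc_eq0. Qed.

(** * Presentation of the Rees algebra *)

Section ReesPresentation.
Variables (A : comNzRingType) (n : nat) (g : 'I_n -> A).

Local Notation S := {mpoly A[n]}.
Local Notation J := (ideal_of (fun x => exists i, x = g i)).

Lemma gen_ideal_mem i : J (g i).
Proof. by apply: ideal_of_mem; exists i. Qed.

Lemma gen_idealP x : J x <-> exists c, x = \sum_i c i * g i.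
Proof.
split=> [|[c ->]]; last first.
  by apply: ideal_sum => i _; apply: idealMl; apply: gen_ideal_mem.
have N0 : exists c : 'I_n -> A, 0 = \sum_i c i * g i.
  by exists (fun=> 0); rewrite big1 // => i _; rewrite mul0r.
have ND y z : (exists c : 'I_n -> A, y = \sum_i c i * g i) ->
  (exists c : 'I_n -> A, z = \sum_i c i * g i) ->
  exists c : 'I_n -> A, y + z = \sum_i c i * g i.
  move=> [u ->] [v ->]; exists (fun i => u i + v i).
  by rewrite -big_split; apply: eq_bigr => i _; rewrite mulrDl.
have NZ c y : (exists u : 'I_n -> A, y = \sum_i u i * g i) ->
  exists u : 'I_n -> A, c * y = \sum_i u i * g i.
  move=> [u ->]; exists (fun i => c * u i).
  by rewrite mulr_sumr; apply: eq_bigr => i _; rewrite mulrA.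
apply: (@ideal_of_sub _ _ (@Submod A A^o _ N0 ND NZ)) => s /= [i ->].
exists (fun j => (j == i)%:R); rewrite (bigD1 i) //= eqxx mul1r.
by rewrite big1 ?addr0 // => j /negPf->; rewrite mul0r.
Qed.

(** The surjection A[T_1, ..., T_n] -> A[J t], T_i |-> g_i t, followed by the
    inclusion of the Rees algebra of J = (g_1, ..., g_n) in A[t]. *)
Definition rees_eval : S -> {poly A} := mmap (@polyC A) (fun i => g i *: 'X).
HB.instance Definition _ := GRing.RMorphism.on rees_eval.

Lemma rees_evalC c : rees_eval c%:MP = c%:P.
Proof. exact: mmapC. Qed.

Lemma rees_evalX i : rees_eval 'X_i = g i *: 'X.
Proof. by rewrite /rees_eval mmapX mmap1U. Qed.

Lemma rees_evalZ c p : rees_eval (c *: p) = c *: rees_eval p.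
Proof. by rewrite -mul_mpolyC rmorphM /= rees_evalC mul_polyC. Qed.

Lemma rees_eval_form (c : 'I_n -> A) :
  rees_eval (\sum_i c i *: 'X_i) = (\sum_i c i * g i) *: 'X.
Proof.
rewrite raddf_sum /= scaler_suml; apply: eq_bigr => i _.
by rewrite /= rees_evalZ rees_evalX scalerA.
Qed.

Lemma rees_eval_in p : rees_eval p \in rees_pred J.
Proof.
elim/mpoly_ring_ind: p => [c|i|p q|p q].
- by rewrite rees_evalC -alg_polyC rpredZ ?rpred1.
- rewrite rees_evalX; pose a := SubLmod (introT (asboolP _) (gen_ideal_mem i)).
  exact: (valP (@rees_degree1 _ J a)).
- by rewrite rmorphD; apply: rpredD.
- by rewrite rmorphM; apply: rpredM.
Qed.

Lemma rees_eval_power i (a : A) :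
  ideal_exp J i a -> exists p, rees_eval p = a *: 'X^i.
Proof.
elim: i a => [|i IHi] a.
  by move=> _; exists a%:MP; rewrite rees_evalC expr0 alg_polyC.
have N0 : exists p, rees_eval p = (0 : A) *: 'X^(i.+1).
  by exists 0; rewrite rmorph0 scale0r.
have ND (u v : A) : (exists p, rees_eval p = u *: 'X^(i.+1)) ->
  (exists p, rees_eval p = v *: 'X^(i.+1)) ->
  exists p, rees_eval p = (u + v) *: 'X^(i.+1).
  by move=> [p Ep] [q Eq]; exists (p + q); rewrite rmorphD /= Ep Eq scalerDl.
have NZ (c u : A) : (exists p, rees_eval p = u *: 'X^(i.+1)) ->
  exists p, rees_eval p = (c * u) *: 'X^(i.+1).
  by move=> [p Ep]; exists (c *: p); rewrite rees_evalZ Ep scalerA.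
apply: (@ideal_of_sub _ _ (@Submod A A^o _ N0 ND NZ)) => _ /= [x Jx [b Jb ->]].
have [p Ep] := IHi b Jb; have [c ->] := (gen_idealP x).1 Jx.
exists ((\sum_i c i *: 'X_i) * p).
by rewrite rmorphM /= Ep rees_eval_form -scalerAl -scalerAr scalerA exprS.
Qed.

Lemma rees_eval_onto (q : {poly A}) :
  q \in rees_pred J -> exists p, rees_eval p = q.
Proof.
move=> /asboolP Jq; rewrite -[q]coefK poly_def.
elim/big_ind: _ => [|u v [p <-] [p' <-]|i _]; first by exists 0; rewrite rmorph0.
  by exists (p + p'); rewrite rmorphD.
exact: rees_eval_power.
Qed.

Definition rees_map (p : S) : Rees J := ReesElt (rees_eval_in p).

Lemma rees_map_linear : linear rees_map.
Proof.
by move=> c p q; apply: val_inj; rewrite /= rmorphD /= rees_evalZ.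
Qed.

Lemma rees_map_multiplicative : monoid_morphism rees_map.
Proof.
split; first by apply: val_inj; rewrite /= rmorph1.
by move=> p q; apply: val_inj; rewrite /= rmorphM.
Qed.

HB.instance Definition _ :=
  GRing.isLinear.Build A S (Rees J) *:%R rees_map rees_map_linear.
HB.instance Definition _ :=
  GRing.isMonoidMorphism.Build S (Rees J) rees_map rees_map_multiplicative.

Lemma rees_map_onto b : exists p, rees_map p = b.
Proof.
by have [p Ep] := rees_eval_onto (valP b); exists p; apply: val_inj.
Qed.

Lemma rees_map_eq0 p : rees_map p = 0 <-> rees_eval p = 0.
Proof. by split=> [/(congr1 val)|E0]; [|apply: val_inj]. Qed.

Definition linear_relation (q : S) :=
  exists2 c, q = \sum_i c i *: 'X_i & \sum_i c i * g i = 0.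

(** The equations of the Rees algebra are generated by those coming from the
    syzygies of the g_i. For a finitely generated ideal this is what linear type
    means; it is in this form that the property is checked and used below. *)
Definition relations_linear :=
  forall p, rees_eval p = 0 -> ideal_of linear_relation p.

End ReesPresentation.

(** * Linear relations and linear type *)

Section CommutativeMonoidAlgebra.
Import finmap.finmap monalg.
Variables (A : comNzRingType) (I : choiceType).

Definition cmonom_poly : comAlgType A := {malg A[{cmonom I}]}.

Definition cmonom_X (i : I) : cmonom_poly :=
  monalg.mkmalgU (monalg.ucm i) (1 : A).

Lemma cmonom_poly1E :
  1 = monalg.mkmalgU (mone : {cmonom I}) (1 : A) :> cmonom_poly.
Proof. by []. Qed.

(** The induction principle [mpoly_ring_ind] for the monoid algebra of the free
    commutative monoid, where the number of variables may be infinite. A monomial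
    other than 1 is a variable times a monomial of smaller degree. *)
Lemma cmonom_poly_ind (P : cmonom_poly -> Prop) :
  (forall c : A, P c%:A) -> (forall i, P (cmonom_X i)) ->
  (forall p q, P p -> P q -> P (p + q)) ->
  (forall p q, P p -> P q -> P (p * q)) -> forall p, P p.
Proof.
move=> PC PX PD PM p.
have P0 : P 0 by rewrite -(scale0r 1).
have mulU (c d : A) (k l : monalg.cmonom I) :
  monalg.mkmalgU (monalg.mmul k l) (c * d) =
  (monalg.mkmalgU k c : cmonom_poly) * (monalg.mkmalgU l d : cmonom_poly).
  by rewrite [RHS]monalg.malgM_def monalg.fgmulUU.
have CE (c : A) : c%:A = monalg.mkmalgU monalg.mone c :> cmonom_poly.
  by rewrite -(monalg.mul_malgC c) mulr1.
have PU k : P (monalg.mkmalgU k 1).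
  have [d] := ubnP (monalg.mdeg k); elim: d k => // d IHd k lt_kd.
  have [/eqP|] := eqVneq (monalg.mdeg k) 0%N.
    by rewrite monalg.mdeg_eq0 => /eqP->; rewrite -CE.
  rewrite monalg.mdegE => nz.
  have [i ki] : exists i, k i != 0%N.
    apply: contrapT => /forallNP k0; case/eqP: nz.
    by rewrite big1 // => i _; apply: contrapT => /eqP/k0.
  pose l := monalg.divcm k (monalg.ucm i).
  have kE : k = monalg.mmul (monalg.ucm i) l.
    apply/eqP/monalg.cmP => j.
    rewrite monalg.cmM monalg.divcmE monalg.ucmE.
    by case: eqP => [<-|]; rewrite ?subn0 // subnKC // lt0n.
  rewrite kE -[1]mulr1 mulU; apply: PM; first exact: PX.
  apply: IHd; move: lt_kd; rewrite {1}kE monalg.mdegM monalg.mdegU.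
  by rewrite addSn ltnS.
rewrite [p]monalg.monalgE; apply: (big_ind P) => [||k _] //.
by rewrite -[monalg.mcoeff k p]mulr1 -[k]monalg.mul1m mulU -CE; apply: PM.
Qed.

End CommutativeMonoidAlgebra.

Section SymmetricClasses.
Import finmap.finmap monalg.

Lemma sym_pi_eq (A : comNzRingType) (M : lmodType A) (p q : cmonom_poly A M) :
  sym_ideal M (p - q) -> sym_pi p = sym_pi q.
Proof.
move=> Ipq; apply/eqP; have : p - q \in @sym_pred A M by apply/asboolP.
by rewrite Quotient.idealrBE.
Qed.

End SymmetricClasses.

Section CmonomPolyMorphisms.
Variables (A : comNzRingType) (I : choiceType).

Lemma cmonom_poly_morph_eq (B : comNzRingType)
    (F G : {rmorphism cmonom_poly A I -> B}) :
  (forall c : A, F c%:A = G c%:A) -> (forall i, F (cmonom_X A i) = G (cmonom_X A i)) ->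
  F =1 G.
Proof.
move=> FC FX; apply: cmonom_poly_ind => // p q.
  by rewrite !rmorphD => -> ->.
by rewrite !rmorphM => -> ->.
Qed.

End CmonomPolyMorphisms.

Section LinearTypeCriterion.
Variables (A : comNzRingType) (n : nat) (g : 'I_n -> A).

Local Notation S := {mpoly A[n]}.
Local Notation J := (ideal_of (fun x => exists i, x = g i)).
Local Notation M := (sub_lmod J).
Local Notation sym_poly := (cmonom_poly A M).
Local Notation sv m := (sym_var m : sym_poly).

Definition ideal_gen (i : 'I_n) : M :=
  SubLmod (introT (asboolP _) (gen_ideal_mem (g := g) i)).

Definition sym_map : S -> sym_poly :=
  mmap (in_alg sym_poly) (fun i => sym_var (ideal_gen i) : sym_poly).
HB.instance Definition _ := GRing.RMorphism.on sym_map.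

Lemma sym_mapC c : sym_map c%:MP = c%:A.
Proof. exact: mmapC. Qed.

Lemma sym_mapX i : sym_map 'X_i = sym_var (ideal_gen i).
Proof. by rewrite /sym_map mmapX mmap1U. Qed.

Lemma sym_mapD p q : sym_map (p + q) = sym_map p + sym_map q.
Proof. exact: rmorphD. Qed.

Lemma sym_mapM p q : sym_map (p * q) = sym_map p * sym_map q.
Proof. exact: rmorphM. Qed.

Lemma sym_map_eval p : sym_eval (@rees_degree1 _ J) (sym_map p) = rees_map g p.
Proof.
elim/mpoly_ring_ind: p => [c|i|p q Ep Eq|p q Ep Eq].
- rewrite sym_mapC sym_evalZ.
  have -> : sym_eval (@rees_degree1 _ J) (1 : sym_poly) = 1.
    by rewrite cmonom_poly1E /sym_eval monalg.mmapU sym_monom1 /= scale1r mulr1.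
  by apply: val_inj; rewrite /= rees_evalC alg_polyC.
- by rewrite sym_mapX sym_eval_var; apply: val_inj; rewrite /= rees_evalX.
- rewrite sym_mapD sym_evalD; transitivity (rees_map g p + rees_map g q).
    by congr (_ + _); [exact: Ep | exact: Eq].
  by apply: val_inj; rewrite /= rmorphD.
- rewrite sym_mapM sym_evalM; transitivity (rees_map g p * rees_map g q).
    by congr (_ * _); [exact: Ep | exact: Eq].
  by apply: val_inj; rewrite /= rmorphM.
Qed.

(** In the symmetric algebra an element of J equals any linear combination of the
    generators that represents it, so that the X_m with m among the generators
    suffice to generate the algebra ([sym_map_onto]). *)
Lemma sym_var_sum (c : 'I_n -> A) (m : M) : val m = \sum_i c i * g i :> A ->
  sym_ideal M (sv m - sym_map (\sum_i c i *: 'X_i)).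
Proof.
move=> Em.
have relD u v : sym_ideal M (sv (u + v) - (sv u + sv v)).
  by apply: ideal_of_mem; left; exists u, v.
have relZ a u : sym_ideal M (sv (a *: u) - a *: sv u).
  by apply: ideal_of_mem; right; exists a, u.
have rel0 : sym_ideal M (sv 0).
  have := relZ 0 0; rewrite !scale0r subr0; exact.
have {Em} -> : m = \sum_i c i *: ideal_gen i.
  by apply: val_inj; rewrite Em raddf_sum.
rewrite [sym_map _]raddf_sum /=.
apply: (big_ind2 (fun (u : M) (v : sym_poly) => sym_ideal M (sv u - v))).
- by rewrite subr0.
- move=> u v u' v' H H'; have := idealD (relD u u') (idealD H H').
  by rewrite [sv u - v + _]addrACA -opprD addrA subrK.
- move=> i _; rewrite -mul_mpolyC sym_mapM sym_mapC sym_mapX -scalerAl mul1r.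
  exact: relZ.
Qed.

Lemma sym_map_onto (p : sym_poly) : exists q, sym_ideal M (p - sym_map q).
Proof.
elim/cmonom_poly_ind: p => [c|m|p p' [q Hq] [q' Hq']|p p' [q Hq] [q' Hq']].
- by exists c%:MP; rewrite sym_mapC subrr; apply: ideal0.
- have [c Em] := (gen_idealP g (val m)).1 (sub_lmodP m).
  exists (\sum_i c i *: 'X_i).
  have -> : cmonom_X A m = sv m by rewrite sym_var.unlock.
  exact: sym_var_sum.
- exists (q + q'); rewrite sym_mapD opprD addrACA; exact: idealD Hq Hq'.
- exists (q * q'); rewrite sym_mapM.
  have -> : p * p' - sym_map q * sym_map q' =
      p' * (p - sym_map q) + sym_map q * (p' - sym_map q').
    by rewrite !mulrBr [p' * p]mulrC [p' * _]mulrC addrA subrK.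
  by apply: idealD; apply: idealMl.
Qed.

(** The two algebras are quotients of A[T_1, ..., T_n]. A polynomial that dies in
    the Rees algebra is a combination of linear forms whose coefficients are
    syzygies, and such a form already dies in the symmetric algebra. *)
Lemma relations_linear_linear_type : relations_linear g -> linear_type J.
Proof.
move=> lin_g.
have liftE := @sym_lift_pi _ _ _ _ (@rees_degree1_linear _ J).
have piE (s : Sym M) : sym_pi (repr s) = s by apply: reprK.
have inj : injective (@sym_to_rees _ J).
  move=> s s'; rewrite -[s]piE -[s']piE; move: (repr s) (repr s') => p p'.
  rewrite /sym_to_rees !liftE => /eqP; rewrite -subr_eq0 -sym_evalB => /eqP.
  have [q Hq] := sym_map_onto (p - p').
  have eval0 (r : sym_poly) : sym_ideal M r -> sym_eval (@rees_degree1 _ J) r = 0.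
    move=> Hr; rewrite -liftE.
    have -> : sym_pi r = sym_pi (0 : sym_poly).
      by apply: sym_pi_eq; rewrite subr0.
    by rewrite liftE sym_eval0.
  move=> E0.
  have /rees_map_eq0/lin_g Rq : rees_map g q = 0.
    by rewrite -sym_map_eval -[LHS]opprK -[- sym_eval _ _]add0r -{1}E0
      -sym_evalB eval0 ?oppr0.
  have Iq : sym_ideal M (sym_map q).
    have N0 : sym_ideal M (sym_map 0) by rewrite rmorph0; apply: ideal0.
    have ND u v : sym_ideal M (sym_map u) -> sym_ideal M (sym_map v) ->
      sym_ideal M (sym_map (u + v)) by rewrite sym_mapD; apply: idealD.
    have NZ a u : sym_ideal M (sym_map u) -> sym_ideal M (sym_map (a * u)).
      by rewrite sym_mapM; apply: idealMl.
    apply: (@ideal_of_sub _ _ (@Submod S S^o _ N0 ND NZ) _ _ Rq) => _ [c -> c0].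
    have m0 : val (0 : M) = \sum_i c i * g i by rewrite c0.
    have H := sym_var_sum m0.
    have H' : sym_ideal M (sv (0 *: (0 : M)) - 0 *: sv 0).
      by apply: ideal_of_mem; right; exists 0, 0.
    rewrite !scale0r subr0 in H'.
    by have := idealB H' H; rewrite opprB addrC subrK.
  apply: sym_pi_eq.
  by have := idealD Hq Iq; rewrite subrK.
have surj (b : Rees J) : exists s, sym_to_rees s = b.
  have [q <-] := rees_map_onto b; exists (sym_pi (sym_map q)).
  by rewrite /sym_to_rees liftE sym_map_eval.
exists (fun b => projT1 (cid (surj b))) => [s|b]; last by case: cid.
by apply: inj; case: cid.
Qed.

End LinearTypeCriterion.

(** * Presentations and complete intersections *)

Section CmonomUniversal.
Import finmap.finmap monalg.
Variables (A : comNzRingType) (n : nat) (B : comAlgType A) (h : 'I_n -> B).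

Let hmon (m : {cmonom 'I_n}) : B := \prod_(i < n) h i ^+ m i.

Fact hmon_morph : mmorphism hmon.
Proof.
split=> [m1 m2|]; rewrite /hmon.
  by rewrite -big_split; apply: eq_bigr => i _; rewrite cmM exprD.
by rewrite big1 // => i _; rewrite cm1 expr0.
Qed.
HB.instance Definition _ := isMultiplicative.Build {cmonom 'I_n} B hmon hmon_morph.

Definition cmonom_eval (p : cmonom_poly A 'I_n) : B := mmap (in_alg B) hmon p.

Fact cmonom_eval_linear : linear cmonom_eval.
Proof.
move=> a p q; rewrite /cmonom_eval mmapD.
by rewrite (@mmapZ _ _ _ (in_alg B) hmon) /= mulr_algl.
Qed.
HB.instance Definition _ :=
  GRing.isLinear.Build A (cmonom_poly A 'I_n) B *:%R cmonom_eval
    cmonom_eval_linear.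

Fact cmonom_eval_monoid : monoid_morphism cmonom_eval.
Proof.
have [M1 M2] := @mmap_is_multiplicative _ A B (in_alg B) hmon.
by split; [exact: M2 | exact: M1].
Qed.
HB.instance Definition _ :=
  GRing.isMonoidMorphism.Build (cmonom_poly A 'I_n) B cmonom_eval
    cmonom_eval_monoid.

Lemma cmonom_evalC (c : A) : cmonom_eval c%:A = c%:A.
Proof. by rewrite linearZ /= rmorph1. Qed.

Lemma cmonom_evalX i : cmonom_eval (cmonom_X A i) = h i.
Proof.
rewrite /cmonom_eval mmapU /= scale1r mul1r /hmon (bigD1 i) //= cmUU expr1.
by rewrite big1 ?mulr1 // => j ji; rewrite cmU eq_sym (negPf ji) expr0.
Qed.

End CmonomUniversal.

Lemma ideal_of_morph (A B : comNzRingType) (F : {rmorphism A -> B})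
    (S : A -> Prop) (S' : B -> Prop) x :
  (forall s, S s -> S' (F s)) -> ideal_of S x -> ideal_of S' (F x).
Proof.
move=> SS'.
have N0 : ideal_of S' (F 0) by rewrite rmorph0; apply: ideal0.
have ND u v : ideal_of S' (F u) -> ideal_of S' (F v) ->
  ideal_of S' (F (u + v)) by rewrite rmorphD; apply: idealD.
have NZ a u : ideal_of S' (F u) -> ideal_of S' (F (a * u)).
  by rewrite rmorphM; apply: idealMl.
apply: (@ideal_of_sub _ _ (@Submod A A^o _ N0 ND NZ)) => s Ss /=.
exact/ideal_of_mem/SS'.
Qed.

Lemma regular_seq_iso (A B : comNzRingType)
    (F : {rmorphism A -> B}) (G : {rmorphism B -> A}) (s : seq A) :
  cancel F G -> cancel G F -> regular_seq s -> regular_seq (map F s).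
Proof.
move=> FK GK [pr reg].
have down i x : ideal_of (fun y => y \in take i (map F s)) x ->
    ideal_of (fun y => y \in take i s) (G x).
  apply: ideal_of_morph => y; rewrite -map_take => /mapP[t ts ->].
  by rewrite FK.
have up i x : ideal_of (fun y => y \in take i s) x ->
    ideal_of (fun y => y \in take i (map F s)) (F x).
  by apply: ideal_of_morph => t ts; rewrite -map_take map_f.
split=> [I1|i x].
  apply: pr; have := down (size s) 1; rewrite take_size rmorph1.
  by rewrite take_oversize ?size_map //; apply.
rewrite size_map => lt_is; rewrite (nth_map 0) // => /down.
rewrite rmorphM /= FK => /(reg _ _ lt_is)/up.
by rewrite GK.
Qed.

(** The polynomial rings [{mpoly A[n]}] and [cmonom_poly A 'I_n] are isomorphic
    A-algebras; a presentation by the first, where computations are done, yields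
    one by the second, which [complete_intersection] refers to. *)
Lemma complete_intersection_mpoly (A : comNzRingType) (B : comAlgType A) n
    (s : seq {mpoly A[n]}) (phi : {lrmorphism {mpoly A[n]} -> B}) :
  regular_seq s -> (forall b, exists p, phi p = b) ->
  (forall p, phi p = 0 <-> ideal_of (fun q => q \in s) p) ->
  complete_intersection B.
Proof.
move=> reg onto ker.
pose F : {rmorphism {mpoly A[n]} -> cmonom_poly A 'I_n} :=
  mmap (in_alg (cmonom_poly A 'I_n)) (fun i => cmonom_X A i).
pose G : {lrmorphism cmonom_poly A 'I_n -> {mpoly A[n]}} :=
  cmonom_eval (fun i => 'X_i : {mpoly A[n]}).
pose Gr : {rmorphism cmonom_poly A 'I_n -> {mpoly A[n]}} := G.
have FC c : F c%:MP = c%:A by apply: mmapC.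
have FX i : F 'X_i = cmonom_X A i by rewrite /F /= mmapX mmap1U.
have GC (c : A) : Gr c%:A = c%:MP  by rewrite [LHS]cmonom_evalC -alg_mpolyC.
have GX i : Gr (cmonom_X A i) = 'X_i by apply: cmonom_evalX.
have FK : cancel F Gr.
  apply: (mpoly_rmorph_eq (F := Gr \o F) (G := idfun)) => [c|i] /=.
    by rewrite FC GC.
  by rewrite FX GX.
have GK : cancel Gr F.
  apply: (cmonom_poly_morph_eq (F := F \o Gr) (G := idfun)) => [c|i] /=.
    by rewrite GC FC.
  by rewrite GX FX.
exists n, (map F s), (phi \o G); split.
- exact: regular_seq_iso FK GK reg.
- by move=> b; have [p <-] := onto b; exists (F p); rewrite /= FK.
move=> p; split=> [/ker|] H.
  rewrite -[p]GK; apply: ideal_of_morph H => t ts; exact: map_f.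
apply/ker; apply: ideal_of_morph H => _ /mapP[t ts ->].
by rewrite FK.
Qed.

(** * Reductions *)

Section Reductions.
Variables (A : comNzRingType) (n : nat) (g : 'I_n -> A).

Local Notation J := (ideal_of (fun x => exists i, x = g i)).
Hypothesis lin_g : relations_linear g.

(** Modulo K every g_i is a multiple a_i g_j of the single element g_j. Put T_i = a_i.
    This sends the equations of the Rees algebra to scalars that carry g_j into K,
    since a syzygy c gives sum_i c_i a_i g_j = sum_i c_i g_i = 0 modulo K. The same
    holds for a suitable lift of any element of K J^r t^(r+1). As T_j^(r+1) goes to 1,
    g_j^(r+1) can lie in K J^r only if g_j lies in K. *)
Lemma cyclic_reduction_step (K : ideal A) (j : 'I_n) (a : 'I_n -> A) r :
  ideal_incl K J -> a j = 1 -> (forall i, K (g i - a i * g j)) ->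
  ideal_incl (ideal_exp J r.+1) (ideal_mul K (ideal_exp J r)) -> K (g j).
Proof.
move=> KJ aj1 aK incl.
(* P p says that the scalar to which p specializes carries g j into K *)
pose chi := meval a; pose P p := K (chi p * g j).
have chi_form c : chi (\sum_i c i *: 'X_i) * g j =
    \sum_i c i * g i - \sum_i c i * (g i - a i * g j).
  rewrite /chi raddf_sum mulr_suml -sumrB; apply: eq_bigr => i _ /=.
  by rewrite mevalZ mevalXU mulrBr subKr mulrA.
have aK_sum (c : 'I_n -> A) : K (\sum_i c i * (g i - a i * g j)).
  by apply: ideal_sum => i _; apply: idealMl.
have P_ker p : rees_eval g p = 0 -> P p.
  have P0 : P 0 by rewrite /P /chi meval0 mul0r; apply: ideal0.
  have PD u v : P u -> P v -> P (u + v).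
    by rewrite /P /chi mevalD mulrDl; apply: idealD.
  have PZ c u : P u -> P (c * u).
    by rewrite /P /chi mevalM -mulrA; apply: idealMl.
  move/lin_g; apply: (@ideal_of_sub _ _ (@Submod _ {mpoly A[n]}^o P P0 PD PZ)) => _ [c -> c0].
  by rewrite /= /P chi_form c0 sub0r; apply: idealN.
have lift x : ideal_mul K (ideal_exp J r) x ->
    exists2 p, rees_eval g p = x *: 'X^(r.+1) & P p.
  pose T (x : A) := exists2 p, rees_eval g p = x *: 'X^(r.+1) & P p.
  have T0 : T 0.
    by exists 0; rewrite /P /chi ?rmorph0 ?scale0r // mul0r; apply: ideal0.
  have TD u v : T u -> T v -> T (u + v).
    move=> [p Ep Pp] [q Eq Pq]; exists (p + q).
      by rewrite rmorphD /= Ep Eq scalerDl.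
    by rewrite /P /chi mevalD mulrDl; apply: idealD.
  have TZ c u : T u -> T (c * u).
    move=> [p Ep Pp]; exists (c *: p); first by rewrite rees_evalZ Ep scalerA.
    by rewrite /P /chi mevalZ -mulrA; apply: idealMl.
  apply: (@ideal_of_sub _ _ (@Submod _ A^o T T0 TD TZ)) => _ [y Ky [b Jb ->]].
  have [q Eq] := rees_eval_power Jb; have [c Ey] := (gen_idealP g y).1 (KJ y Ky).
  exists (q * (\sum_i c i *: 'X_i)).
    rewrite rmorphM /= Eq rees_eval_form -Ey -scalerAl -scalerAr scalerA.
    by rewrite mulrC exprSr.
  rewrite /P /chi mevalM -mulrA; apply: idealMl.
  by rewrite -/chi chi_form -Ey; apply: idealB.
have Jpow m : ideal_exp J m (g j ^+ m).
  elim: m => [|m IHm]; first exact: ideal_exp0.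
  apply: ideal_of_mem; exists (g j); first exact: gen_ideal_mem.
  by exists (g j ^+ m); rewrite ?exprS.
have [p Ep Pp] := lift _ (incl _ (Jpow r.+1)).
have : P ('X_j ^+ r.+1 - p).
  apply: P_ker; rewrite rmorphB rmorphXn /= Ep rees_evalX.
  by rewrite exprZn subrr.
rewrite /P /chi mevalB rmorphXn /= mevalXU aj1 expr1n mulrBl mul1r.
by move=> /(idealD Pp); rewrite addrC subrK.
Qed.

(** Adding to a reduction K the first m generators of J gives an increasing
    chain from K to J, all of whose members are reductions with the same exponent.
    Each step of the chain is cyclic, hence trivial by [cyclic_reduction_step]. *)
Lemma relations_linear_no_reduction (K : ideal A) :
  reduction K J -> ideal_incl J K.
Proof.
move=> [KJ [r red]].
pose Km m := ideal_of (fun x : A => K x \/ exists2 i : 'I_n, (i < m)%N & x = g i).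
have KKm m : ideal_incl K (Km m) by move=> x Kx; apply: ideal_of_mem; left.
have KmJ m : ideal_incl (Km m) J.
  by move=> x; apply: ideal_of_sub => y [/KJ|[i _ ->]] //; apply: gen_ideal_mem.
have incl m : ideal_incl (ideal_exp J r.+1) (ideal_mul (Km m) (ideal_exp J r)).
  move=> x /red; apply: ideal_of_sub => _ [y Ky [b Jb ->]].
  by apply: ideal_of_mem; exists y; [apply: KKm | exists b].
suff down m : ideal_incl J (Km m) -> ideal_incl J K.
  apply: (down n) => x; apply: ideal_of_sub => _ [i ->].
  by apply: ideal_of_mem; right; exists i.
elim: m => [|m IHm] Jm.
  by move=> x /Jm; apply: ideal_of_sub => y [|[]].
apply: IHm => x /Jm.
have [lt_mn|le_nm] := ltnP m n; last first.
  apply: ideal_of_sub => y [Ky|[i _ ->]]; first exact: KKm.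
  by apply: ideal_of_mem; right; exists i => //; apply: leq_trans le_nm.
pose j := Ordinal lt_mn.
have split y : Km m.+1 y -> exists a, Km m (y - a * g j).
  pose T y := exists a, Km m (y - a * g j).
  have T0 : T 0 by exists 0; rewrite mul0r subrr; apply: ideal0.
  have TD u v : T u -> T v -> T (u + v).
    move=> [a Ha] [b Hb]; exists (a + b).
    by rewrite mulrDl opprD addrACA; apply: idealD.
  have TZ c u : T u -> T (c * u).
    by move=> [a Ha]; exists (c * a); rewrite -mulrA -mulrBr; apply: idealMl.
  apply: (@ideal_of_sub _ _ (@Submod _ A^o T T0 TD TZ)) => u [Ku|[i im ->]].
    by exists 0; rewrite mul0r subr0; apply: KKm.
  have [->|ij] := eqVneq i j; first by exists 1; rewrite mul1r subrr; apply: ideal0.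
  exists 0; rewrite mul0r subr0; apply: ideal_of_mem; right; exists i => //.
  by rewrite ltn_neqAle ij -ltnS.
have [a Ha] : exists a : 'I_n -> A, forall i, Km m (g i - a i * g j).
  have gK i := cid (split _ (Jm _ (gen_ideal_mem i))).
  by exists (fun i => projT1 (gK i)) => i; case: (gK i).
pose a' i := if i == j then 1 else a i.
have Kj : Km m (g j).
  apply: (@cyclic_reduction_step (Km m) j a' r) => //; rewrite /a' ?eqxx // => i.
  by case: eqP => [->|_] //; rewrite mul1r subrr; apply: ideal0.
apply: ideal_of_sub => y [Ky|[i im ->]]; first exact: KKm.
have [->|ij] := eqVneq i j => //.
apply: ideal_of_mem; right; exists i => //.
by rewrite ltn_neqAle ij -ltnS.
Qed.

Lemma relations_linear_reduction_number : is_reduction_number J 0.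
Proof.
have red0 : reduces_at J J 0 by move=> x.
split=> //; exists J; last by split.
split; first by split=> //; exists 0%N.
move=> K' redK' K'J x; split; first exact: K'J.
exact: relations_linear_no_reduction.
Qed.

End Reductions.

(** * Retractions and splitting fields *)

(** An A-linear left inverse of A -> B. Applying it to a relation over B between
    elements of A gives a relation over A, so membership in an ideal generated by
    elements of A can be tested over B ([retraction_comb1], [retraction_comb2]). *)
Definition retraction (A B : nzRingType) (iota : A -> B) (pi : B -> A) :=
  (forall a b, pi (iota a * b) = a * pi b) /\ pi 1 = 1.

Lemma retractionK (A B : nzRingType) (iota : A -> B) (pi : B -> A) :
  retraction iota pi -> cancel iota pi.
Proof. by move=> [piM pi1] a; rewrite -[iota a]mulr1 piM pi1 mulr1. Qed.

Lemma retraction_comb1 (A B : comNzRingType) (iota : {rmorphism A -> B})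
    (pi : {additive B -> A}) p a u :
  retraction iota pi -> iota p = u * iota a -> p = pi u * a.
Proof.
move=> ret Ep; rewrite -[p](retractionK ret) Ep.
by rewrite [_ * iota _]mulrC ret.1 mulrC.
Qed.

Lemma retraction_comb2 (A B : comNzRingType) (iota : {rmorphism A -> B})
    (pi : {additive B -> A}) p a b u v :
  retraction iota pi -> iota p = u * iota a + v * iota b ->
  p = pi u * a + pi v * b.
Proof.
move=> ret Ep; rewrite -[p](retractionK ret) Ep raddfD /=.
by rewrite ![_ * iota _]mulrC !ret.1 ![_ * pi _]mulrC.
Qed.

Lemma retraction_comp (A B C : nzRingType) (i1 : A -> B) (p1 : B -> A)
    (i2 : B -> C) (p2 : C -> B) :
  retraction i1 p1 -> retraction i2 p2 -> retraction (i2 \o i1) (p1 \o p2).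
Proof.
move=> [M1 U1] [M2 U2]; split=> [a b|] /=; last by rewrite U2 U1.
by rewrite M2 M1.
Qed.

Lemma retraction_map_mpoly n (A B : nzRingType) (iota : {rmorphism A -> B})
    (pi : {additive B -> A}) :
  retraction iota pi ->
  retraction (map_mpoly iota : {mpoly A[n]} -> _) (map_mpoly pi).
Proof.
move=> [piM pi1]; split=> [p q|].
  apply/mpolyP => m; rewrite mcoeff_map_mpoly !mcoeffM raddf_sum.
  by apply: eq_bigr => d _; rewrite /= !mcoeff_map_mpoly piM.
by apply/mpolyP => m; rewrite mcoeff_map_mpoly !mcoeff1; case: eqP; rewrite ?raddf0.
Qed.

Lemma retraction_cancel (A B : nzRingType) (F : {rmorphism A -> B})
    (G : {rmorphism B -> A}) : cancel F G -> retraction F G.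
Proof. by move=> FK; split=> [a b|]; rewrite ?rmorphM ?rmorph1 //= FK. Qed.

Lemma irreducible_factor (k : fieldType) (p : {poly k}) :
  (1 < size p)%N -> exists2 q, irreducible_poly q & q %| p.
Proof.
have [m] := ubnP (size p); elim: m p => // m IHm p lt_pm p_gt1.
have [irr|] := pselect (irreducible_poly p); first by exists p.
move=> red; have [q [q1 qp nqp]] : exists q : {poly k},
    [/\ size q != 1%N, q %| p & ~~ (q %= p)].
  apply: contrapT => none; apply: red; split=> // q q1 qp.
  by apply: contrapT => /negP nqp; apply: none; exists q.
have p0 : p != 0 by rewrite -size_poly_gt0 ltnW.
have lt_qp : (size q < size p)%N.
  by rewrite ltn_neqAle dvdp_leq // andbT dvdp_size_eqp.
have q0 : (0 < size q)%N.
  by rewrite size_poly_gt0; apply: contraNneq p0 => q0; rewrite q0 dvd0p in qp.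
have [||r irr rq] := IHm q.
- exact: leq_trans lt_qp _.
- by rewrite ltn_neqAle eq_sym q1.
- by exists r => //; apply: dvdp_trans qp.
Qed.

(** Adjoin the roots one at a time; each simple extension is a vector space over
    the previous field, so the coordinate along 1 is a retraction, and
    retractions compose. *)
Lemma splitting_field_retraction (k : fieldType) (p : {poly k}) :
  p != 0 ->
  exists (L : fieldType) (iota : {rmorphism k -> L}) (pi : {additive L -> k})
    (rs : seq L),
  retraction iota pi /\
  map_poly iota p = iota (lead_coef p) *: \prod_(r <- rs) ('X - r%:P).
Proof.
have [m] := ubnP (size p); elim: m k p => // m IHm k p lt_pm p0.
have [le_p1|p_gt1] := leqP (size p) 1.
  exists k, idfun, idfun, [::]; split; first by split.
  have [c ->] : exists c, p = c%:P by exists p`_0; apply: size1_polyC.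
  by rewrite big_nil map_polyC lead_coefC alg_polyC.
have [q irr_q /dvdpP[p1 Ep]] := irreducible_factor p_gt1.
have [L dimL [z qz0 _]] := irredp_FAdjoin irr_q.
pose i1 : {rmorphism k -> L} := in_alg L.
have free1 : free [tuple (1 : L)] by rewrite seq1_free oner_eq0.
pose p1' : {additive L -> k} := coord [tuple (1 : L)] ord0.
have ret1 : retraction i1 p1'.
  split=> [a b|]; first by rewrite /i1 /p1' /= mulr_algl linearZ.
  by have := coord_free ord0 ord0 free1; rewrite eqxx.
have : root (map_poly i1 p) z by rewrite Ep rmorphM rootM qz0 orbT.
case/factor_theorem=> u Eu.
have mp0 : map_poly i1 p != 0 by rewrite map_poly_eq0.
have u0 : u != 0 by apply: contraNneq mp0 => u0; rewrite Eu u0 mul0r.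
have lcu : lead_coef u = i1 (lead_coef p).
  by rewrite -(lead_coef_map i1) Eu lead_coef_Mmonic ?monicXsubC.
have [|L2 [i2 [p2 [rs [ret2 Eu2]]]]] := IHm L u _ u0.
  have := congr1 (size : {poly L} -> nat) Eu.
  rewrite size_map_poly size_Mmonic ?monicXsubC // size_XsubC addn2 /= => Es.
  by rewrite -Es.
exists L2, (i2 \o i1 : {rmorphism k -> L2}), (p1' \o p2 : {additive L2 -> k}),
  (i2 z :: rs); split; first exact: retraction_comp.
rewrite map_poly_comp Eu rmorphM /= Eu2 map_polyXsubC big_cons mulrC -scalerAr.
by rewrite lcu.
Qed.

(** * Kernels of monomial maps *)

Lemma ord3P (P : 'I_3 -> Prop) : P 0 -> P 1 -> P 2 -> forall i, P i.
Proof.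
move=> P0 P1 P2 i; case: i => [[|[|[|//]]] lt_i].
- by rewrite (_ : Ordinal _ = 0) //; apply: val_inj.
- by rewrite (_ : Ordinal _ = 1) //; apply: val_inj.
- by rewrite (_ : Ordinal _ = 2) //; apply: val_inj.
Qed.

Lemma sum_ord3 (V : nmodType) (F : 'I_3 -> V) :
  \sum_(i < 3) F i = F 0 + F 1 + F 2.
Proof.
rewrite !big_ord_recl big_ord0 addr0 addrA.
by congr (F _ + F _ + F _); apply: val_inj.
Qed.

Lemma prod_ord3 (A : comPzRingType) (F : 'I_3 -> A) :
  \prod_(i < 3) F i = F 0 * F 1 * F 2.
Proof.
rewrite !big_ord_recl big_ord0 mulr1 mulrA.
by congr (F _ * F _ * F _); apply: val_inj.
Qed.

Section MonomialExtension.
Variables (n : nat) (A : nzRingType) (V : zmodType) (H : 'X_{1..n} -> A -> V).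
Hypothesis HD : forall m, {morph H m : a b / a + b}.

(** The additive extension of a map prescribed on the terms a X^m. *)
Definition monomial_ext (p : {mpoly A[n]}) : V :=
  \sum_(m <- msupp p) H m p@_m.

Let H0 m : H m 0 = 0.
Proof. by apply: (addrI (H m 0)); rewrite -HD !addr0. Qed.

Lemma monomial_extE p k : (msize p <= k)%N ->
  monomial_ext p = \sum_(m : 'X_{1..n < k}) H m p@_m.
Proof.
move=> le_pk; rewrite /monomial_ext.
rewrite (big_mksub 'X_{1..n < k}) ?msupp_uniq //=; last first.
  by move=> m /msize_mdeg_lt /leq_trans; apply.
by rewrite big_rmcond //= => m /memN_msupp_eq0 ->.
Qed.

Lemma monomial_extD : {morph monomial_ext : p q / p + q}.
Proof.
move=> p q; pose k := maxn (msize (p + q)) (maxn (msize p) (msize q)).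
rewrite !(@monomial_extE _ k) ?leq_max ?leqnn ?orbT //.
by rewrite -big_split; apply: eq_bigr => m _; rewrite mcoeffD HD.
Qed.

Lemma monomial_extX c m : monomial_ext (c *: 'X_[m]) = H m c.
Proof.
have [->|c0] := eqVneq c 0.
  by rewrite scale0r /monomial_ext msupp0 big_nil H0.
by rewrite /monomial_ext msuppMCX // big_seq1 mcoeffZ mcoeffX eqxx mulr1.
Qed.

End MonomialExtension.

Section NestedMonomials.
Variable L : comNzRingType.
Local Notation R := {mpoly L[3]}.
Local Notation S := {mpoly R[3]}.

Definition nconst (a : L) : S := a%:MP%:MP.
Definition nmonom (e d : 'X_{1..3}) : S := 'X_[e] *: 'X_[d].

Lemma nested_monomE (p : S) : p = \sum_(d <- msupp p) \sum_(e <- msupp p@_d)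
  nconst (p@_d@_e) * nmonom e d.
Proof.
rewrite [LHS]mpolyE; apply: eq_bigr => d _.
rewrite [in LHS](mpolyE p@_d) scaler_suml; apply: eq_bigr => e _.
by rewrite /nconst /nmonom mul_mpolyC scalerA mul_mpolyC.
Qed.

Definition nested_ext (beta : 'X_{1..3} -> 'X_{1..3} -> S) : S -> S :=
  monomial_ext (fun d => monomial_ext (fun e a => nconst a * beta e d)).

Lemma nconstD a b : nconst (a + b) = nconst a + nconst b.
Proof. by rewrite /nconst !mpolyCD. Qed.

Lemma nested_extD beta : {morph nested_ext beta : p q / p + q}.
Proof.
apply: monomial_extD => d; apply: monomial_extD => e a b.
by rewrite nconstD mulrDl.
Qed.

Lemma nested_ext_monom beta a e d :
  nested_ext beta (nconst a * nmonom e d) = nconst a * beta e d.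
Proof.
rewrite /nconst /nmonom mul_mpolyC scalerA mul_mpolyC -/(nconst a) /nested_ext.
rewrite monomial_extX; last first.
  by move=> m; apply: monomial_extD => e' b c; rewrite nconstD mulrDl.
by rewrite monomial_extX // => e' b c; rewrite nconstD mulrDl.
Qed.

(** Suppose that F maps monomials to monomials, and that beta recovers from the image
    of a monomial a monomial congruent to it modulo I. The additive extension rho of
    beta then satisfies p = rho (F p) modulo I for all p, because this can be
    checked on terms. So F p = 0 forces p to lie in I. *)
Lemma monomial_kernel (F : {rmorphism S -> S}) (I : ideal S)
    (beta : 'X_{1..3} -> 'X_{1..3} -> S) :
  (forall a, F (nconst a) = nconst a) ->
  (forall e d, exists e' d', F (nmonom e d) = nmonom e' d' /\
    I (nmonom e d - beta e' d')) ->
  forall p, F p = 0 -> I p.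
Proof.
move=> FC FM p Fp0.
have rho0 : nested_ext beta 0 = 0.
  by apply: (addrI (nested_ext beta 0)); rewrite -nested_extD !addr0.
suff : I (p - nested_ext beta (F p)) by rewrite Fp0 rho0 subr0.
pose P q := I (q - nested_ext beta (F q)).
have PD q q' : P q -> P q' -> P (q + q').
  by rewrite /P rmorphD nested_extD opprD addrACA; apply: idealD.
have P0 : P 0 by rewrite /P rmorph0 rho0 subr0; apply: ideal0.
suff : P p by [].
rewrite [p]nested_monomE; apply: (big_ind P); [exact: P0 | exact: PD | move=> d _].
apply: (big_ind P); [exact: P0 | exact: PD | move=> e _]; have [e' [d' [FE IE]]] := FM e d.
rewrite /P rmorphM /= FC FE nested_ext_monom -mulrBr; exact: idealMl.
Qed.

End NestedMonomials.

Lemma binomial_congruence (A : comNzRingType) (I : ideal A) (w0 w1 w2 m : A) r s :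
  I (w0 - w1) -> I (w1 - w2) ->
  I (m * (w1 ^+ r * w2 ^+ s) - m * w0 ^+ (r + s)).
Proof.
move=> I01 I12; have I02 : I (w0 - w2) by have := idealD I01 I12; rewrite subrKA.
have IX (u v : A) k : I (u - v) -> I (u ^+ k - v ^+ k).
  by move=> Iuv; rewrite subrXX; apply: ideal_mulr.
rewrite -mulrBr; apply: idealMl; rewrite -opprB; apply: idealN.
rewrite exprD; have -> : w0 ^+ r * w0 ^+ s - w1 ^+ r * w2 ^+ s =
  w0 ^+ s * (w0 ^+ r - w1 ^+ r) + w1 ^+ r * (w0 ^+ s - w2 ^+ s) by ring.
by apply: idealD; apply: idealMl; apply: IX.
Qed.

Lemma rmorph_monomial (A B : comNzRingType) (F : {rmorphism A -> B})
    (x0 x1 x2 t0 t1 t2 : A) a b c a' b' c' :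
  F (x0 ^+ a * x1 ^+ b * x2 ^+ c * (t0 ^+ a' * t1 ^+ b' * t2 ^+ c')) =
  F x0 ^+ a * F x1 ^+ b * F x2 ^+ c * (F t0 ^+ a' * F t1 ^+ b' * F t2 ^+ c').
Proof. by rewrite !rmorphM !rmorphXn. Qed.

Lemma toric_monomial (A : comNzRingType) (x0 x1 x2 t t1 t2 : A) a b c a' b' c' :
  x0 ^+ a * x1 ^+ b * x2 ^+ c *
    ((x1 * x2 * t) ^+ a' * (x0 * x2 * t) ^+ b' * (x0 * x1 * t) ^+ c') =
  x0 ^+ (a + b' + c') * x1 ^+ (b + a' + c') * x2 ^+ (c + a' + b') *
    (t ^+ (a' + b' + c') * t1 ^+ 0 * t2 ^+ 0).
Proof. by rewrite !exprMn !exprD !expr0; ring. Qed.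

Lemma toric_congruence (A : comNzRingType) (I : ideal A)
    (x0 x1 x2 t0 t1 t2 : A) a b c a' b' c' r s :
  I (x0 * t0 - x1 * t1) -> I (x1 * t1 - x2 * t2) ->
  I (x0 ^+ a * x1 ^+ (b + r) * x2 ^+ (c + s) *
       (t0 ^+ a' * t1 ^+ (b' + r) * t2 ^+ (c' + s)) -
     x0 ^+ (a + r + s) * x1 ^+ b * x2 ^+ c *
       (t0 ^+ (a' + r + s) * t1 ^+ b' * t2 ^+ c')).
Proof.
move=> I01 I12; pose m := x0 ^+ a * x1 ^+ b * x2 ^+ c *
  (t0 ^+ a' * t1 ^+ b' * t2 ^+ c').
have := binomial_congruence m r s I01 I12; congr (I _).
by rewrite /m !exprMn !exprD; ring.
Qed.

Lemma conifold_monomial (A : comNzRingType) (x0 x1 x2 t t1 t2 : A) a b c a' b' c' :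
  x0 ^+ a * x1 ^+ b * x2 ^+ c * ((x1 * t) ^+ a' * (x0 * t) ^+ b' * t2 ^+ c') =
  x0 ^+ (a + b') * x1 ^+ (b + a') * x2 ^+ c *
    (t ^+ (a' + b') * t1 ^+ 0 * t2 ^+ c').
Proof. by rewrite !exprMn !exprD !expr0; ring. Qed.

Lemma conifold_congruence (A : comNzRingType) (I : ideal A)
    (x0 x1 x2 t0 t1 t2 : A) a b c a' b' c' r :
  I (x0 * t0 - x1 * t1) ->
  I (x0 ^+ a * x1 ^+ (b + r) * x2 ^+ c * (t0 ^+ a' * t1 ^+ (b' + r) * t2 ^+ c') -
     x0 ^+ (a + r) * x1 ^+ b * x2 ^+ c * (t0 ^+ (a' + r) * t1 ^+ b' * t2 ^+ c')).
Proof.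
move=> I01; pose m := x0 ^+ a * x1 ^+ b * x2 ^+ c *
  (t0 ^+ a' * t1 ^+ b' * t2 ^+ c').
have I0 : I (x1 * t1 - x1 * t1) by rewrite subrr; apply: ideal0.
have := binomial_congruence m r 0 I01 I0; congr (I _).
by rewrite /m addn0 expr0 !exprMn !exprD; ring.
Qed.

(** Locked: otherwise unifying two of these variables unfolds the construction of
    the polynomial rings. *)
HB.lock Definition nvar (L : nzRingType) (i : 'I_3) : {mpoly {mpoly L[3]}[3]} :=
  ('X_i)%:MP.

Section BinomialKernels.
Variable L : idomainType.
Local Notation R := {mpoly L[3]}.
Local Notation S := {mpoly R[3]}.

Local Notation X i := (nvar L i).
Local Notation T i := ('X_i : S).
Local Notation w i := (X i * T i).

Definition mnm3 (a b c : nat) : 'X_{1..3} := [multinom [tuple a; b; c]].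

Lemma mnm3_0 a b c : mnm3 a b c 0 = a. Proof. by []. Qed.
Lemma mnm3_1 a b c : mnm3 a b c 1 = b. Proof. by []. Qed.
Lemma mnm3_2 a b c : mnm3 a b c 2 = c. Proof. by []. Qed.
Definition mnm3E := (mnm3_0, mnm3_1, mnm3_2).

Lemma nmonomE e d : nmonom L e d =
  X 0 ^+ e 0 * X 1 ^+ e 1 * X 2 ^+ e 2 * (T 0 ^+ d 0 * T 1 ^+ d 1 * T 2 ^+ d 2).
Proof.
have XE (f : 'X_{1..3}) : ('X_[f] : R)%:MP = X 0 ^+ f 0 * X 1 ^+ f 1 * X 2 ^+ f 2.
  rewrite nvar.unlock mpolyXE_id prod_ord3 2!mpolyCM.
  by congr (_ * _ * _); apply: rmorphXn.
by rewrite /nmonom -mul_mpolyC XE mpolyXE_id prod_ord3.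
Qed.

Lemma nmonom3E a b c a' b' c' : nmonom L (mnm3 a b c) (mnm3 a' b' c') =
  X 0 ^+ a * X 1 ^+ b * X 2 ^+ c * (T 0 ^+ a' * T 1 ^+ b' * T 2 ^+ c').
Proof. by rewrite nmonomE !mnm3E. Qed.

(** The Rees equations of the gradient of x0 x1 x2, with T_0 as the variable t.
    A monomial of image x0^A x1^B x2^C t^D has e_1 - d_1 = B - D and
    e_2 - d_2 = C - D, where e and d are its exponents in x and T. The monomial chosen
    by beta is the one with min (e_1, d_1) = min (e_2, d_2) = 0; it is reached by
    replacing x1 T1 and x2 T2 with x0 T0. *)
Lemma toric_kernel (F : {rmorphism S -> S}) p :
  (forall c : R, F c%:MP = c%:MP) -> F (T 0) = X 1 * X 2 * T 0 ->
  F (T 1) = X 0 * X 2 * T 0 -> F (T 2) = X 0 * X 1 * T 0 ->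
  F p = 0 -> exists u v, p = u * (w 0 - w 1) + v * (w 1 - w 2).
Proof.
move=> FC F0 F1 F2 Fp0; apply/ideal_of2P.
set I : ideal S := ideal_of _.
have I01 : I (w 0 - w 1) by apply: ideal_of_mem; rewrite mem_head.
have I12 : I (w 1 - w 2) by apply: ideal_of_mem; rewrite in_cons mem_head orbT.
move: I I01 I12 => I I01 I12.
have FX i : F (X i) = X i by rewrite nvar.unlock FC.
pose beta (e d : 'X_{1..3}) : S :=
  nmonom L (mnm3 (e 0 - (d 0 - e 1) - (d 0 - e 2)) (e 1 - d 0) (e 2 - d 0))
    (mnm3 (d 0 - (d 0 - e 1) - (d 0 - e 2)) (d 0 - e 1) (d 0 - e 2)).
apply: (@monomial_kernel _ F I beta) Fp0 => [a|e d]; first exact: FC.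
exists (mnm3 (e 0 + d 1 + d 2) (e 1 + d 0 + d 2) (e 2 + d 0 + d 1)).
exists (mnm3 (d 0 + d 1 + d 2) 0 0); split.
  rewrite nmonomE nmonom3E rmorph_monomial !FX F0 F1 F2.
  exact: toric_monomial.
rewrite /beta !mnm3E nmonom3E nmonomE.
pose r := minn (e 1) (d 1); pose s := minn (e 2) (d 2).
pose b := (e 1%R - d 1%R)%N; pose b' := (d 1%R - e 1%R)%N.
pose c := (e 2%R - d 2%R)%N; pose c' := (d 2%R - e 2%R)%N.
set A1 := (d 0%R + d 1%R + d 2%R - (e 1%R + d 0%R + d 2%R))%N.
set A2 := (d 0%R + d 1%R + d 2%R - (e 2%R + d 0%R + d 1%R))%N.
have -> : A1 = b' by rewrite /A1 /b'; lia.
have -> : A2 = c' by rewrite /A2 /c'; lia.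
have -> : (e 1%R + d 0%R + d 2%R - (d 0%R + d 1%R + d 2%R) = b)%N by rewrite /b; lia.
have -> : (e 2%R + d 0%R + d 1%R - (d 0%R + d 1%R + d 2%R) = c)%N by rewrite /c; lia.
have -> : (e 0%R + d 1%R + d 2%R - b' - c' = e 0%R + r + s)%N by rewrite /b' /c' /r /s; lia.
have -> : (d 0%R + d 1%R + d 2%R - b' - c' = d 0%R + r + s)%N by rewrite /b' /c' /r /s; lia.
have -> : e 1 = (b + r)%N by rewrite /b /r; lia.
have -> : d 1 = (b' + r)%N by rewrite /b' /r; lia.
have -> : e 2 = (c + s)%N by rewrite /c /s; lia.
have -> : d 2 = (c' + s)%N by rewrite /c' /s; lia.
exact: (toric_congruence (e 0) b c (d 0) b' c' r s I01 I12).
Qed.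

(** The quotient by x0 T0 - x1 T1 embeds in the polynomial ring, so this
    binomial generates a prime ideal. The argument is that of [toric_kernel]. *)
Lemma conifold_kernel (F : {rmorphism S -> S}) p :
  (forall c : R, F c%:MP = c%:MP) -> F (T 0) = X 1 * T 0 ->
  F (T 1) = X 0 * T 0 -> F (T 2) = T 2 ->
  F p = 0 -> exists u, p = u * (w 0 - w 1).
Proof.
move=> FC F0 F1 F2 Fp0; apply/ideal_of1P.
set I : ideal S := ideal_of _.
have I01 : I (w 0 - w 1) by apply: ideal_of_mem; rewrite mem_head.
move: I I01 => I I01.
have FX i : F (X i) = X i by rewrite nvar.unlock FC.
pose beta (e d : 'X_{1..3}) : S :=
  nmonom L (mnm3 (e 0 - (d 0 - e 1)) (e 1 - d 0) (e 2))
    (mnm3 (d 0 - (d 0 - e 1)) (d 0 - e 1) (d 2)).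
apply: (@monomial_kernel _ F I beta) Fp0 => [a|e d]; first exact: FC.
exists (mnm3 (e 0 + d 1) (e 1 + d 0) (e 2)), (mnm3 (d 0 + d 1) 0 (d 2)); split.
  rewrite nmonomE nmonom3E rmorph_monomial !FX F0 F1 F2.
  exact: conifold_monomial.
rewrite /beta !mnm3E nmonom3E nmonomE.
pose r := minn (e 1) (d 1).
pose b := (e 1%R - d 1%R)%N; pose b' := (d 1%R - e 1%R)%N.
have -> : (d 0%R + d 1%R - (e 1%R + d 0%R) = b')%N by rewrite /b'; lia.
have -> : (e 1%R + d 0%R - (d 0%R + d 1%R) = b)%N by rewrite /b; lia.
have -> : (e 0%R + d 1%R - b' = e 0%R + r)%N by rewrite /b' /r; lia.
have -> : (d 0%R + d 1%R - b' = d 0%R + r)%N by rewrite /b' /r; lia.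
have -> : e 1 = (b + r)%N by rewrite /b /r; lia.
have -> : d 1 = (b' + r)%N by rewrite /b' /r; lia.
exact: (conifold_congruence (X 2) (T 2) (e 0) b (e 2) (d 0) b' (d 2) r I01).
Qed.

(** The ideal of x0 T0 - x1 T1 is prime, being the kernel F of [conifold_kernel],
    and F (x1 T1 - x2 T2) is not zero. *)
Lemma toric_syzygy p q : p * (w 1 - w 2) = q * (w 0 - w 1) ->
  exists u, p = u * (w 0 - w 1).
Proof.
move=> Epq.
pose h (i : 'I_3) : S :=
  if i == 0 then X 1 * T 0 else if i == 1 then X 0 * T 0 else T 2.
pose F : {rmorphism S -> S} := mmap (@mpolyC 3 R) h.
have FC c : F c%:MP = c%:MP by apply: mmapC.
have FX i : F (X i) = X i by rewrite nvar.unlock FC.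
have FT i : F (T i) = h i by rewrite /F /= mmapX mmap1U.
have F0 : F (T 0) = X 1 * T 0 by rewrite FT.
have F1 : F (T 1) = X 0 * T 0 by rewrite FT.
have F2 : F (T 2) = T 2 by rewrite FT.
apply: (conifold_kernel FC F0 F1 F2).
have FB i j : F (w i - w j) = X i * F (T i) - X j * F (T j).
  by rewrite rmorphB (rmorphM F (X i)) (rmorphM F (X j)) !FX.
have : F p * F (w 1 - w 2) = 0.
  rewrite -(rmorphM F p) Epq (rmorphM F q) (FB 0 1) F0 F1.
  have -> : X 0 * (X 1 * T 0) - X 1 * (X 0 * T 0) = 0.
    by rewrite mulrCA subrr.
  by rewrite mulr0.
move/eqP; rewrite mulf_eq0 => /orP[/eqP//|]; rewrite (FB 1 2) F1 F2 => /eqP E0.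
have := congr1 (fun q : S => meval (fun=> 1) (meval (fun i : 'I_3 => (i == 0)%:R) q)) E0.
rewrite !meval0 mevalB !mevalM !mevalXU nvar.unlock !mevalC /= mulr0 subr0 mulr1.
by rewrite mevalM !mevalXU mulr1 => /eqP; rewrite oner_eq0.
Qed.

End BinomialKernels.

(** * Linear changes of coordinates *)

Lemma mderivX1 (A : nzRingType) n (a b : 'I_n) :
  ('X_a : {mpoly A[n]})^`M(b) = (a == b)%:R.
Proof.
rewrite mderivX mnm1E; case: eqP => [->|_]; last by rewrite scale0r.
rewrite scale1r -mpolyX0; congr 'X_[_].
by apply/mnmP => m; rewrite mnmBE subnn mnm0E.
Qed.

Section LinearSubstitution.
Variable n : nat.

Definition lin_subst (B : comNzRingType) (M : 'M[B]_n) : {mpoly B[n]} -> {mpoly B[n]} :=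
  mmap (@mpolyC n B) (fun i => \sum_j M i j *: 'X_j).
HB.instance Definition _ B M := GRing.RMorphism.on (@lin_subst B M).

Lemma lin_substC (B : comNzRingType) (M : 'M[B]_n) c : lin_subst M c%:MP = c%:MP.
Proof. exact: mmapC. Qed.

Lemma lin_substX (B : comNzRingType) (M : 'M[B]_n) i :
  lin_subst M 'X_i = \sum_j M i j *: 'X_j.
Proof. by rewrite /lin_subst mmapX mmap1U. Qed.

Lemma lin_substZ (B : comNzRingType) (M : 'M[B]_n) c p :
  lin_subst M (c *: p) = c *: lin_subst M p.
Proof. by rewrite -!mul_mpolyC rmorphM /= lin_substC. Qed.

Lemma mulmx1E (B : comNzRingType) (M N : 'M[B]_n) :
  M *m N = 1%:M -> forall i l, \sum_j M i j * N j l = (i == l)%:R.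
Proof. by move=> /matrixP MN1 i l; have := MN1 i l; rewrite !mxE. Qed.

Lemma lin_substK (B : comNzRingType) (M N : 'M[B]_n) :
  M *m N = 1%:M -> cancel (lin_subst M) (lin_subst N).
Proof.
move=> MN1; have MNE := mulmx1E MN1.
apply: (mpoly_rmorph_eq (F := lin_subst N \o lin_subst M) (G := idfun)).
  by move=> c; rewrite /= !lin_substC.
move=> i; rewrite /= lin_substX raddf_sum /=.
under eq_bigr => j _ do rewrite lin_substZ lin_substX scaler_sumr.
rewrite exchange_big /= (bigD1 i) //= [X in _ + X]big1 => [|l li].
  under eq_bigr => j _ do rewrite scalerA.
  by rewrite -scaler_suml MNE eqxx scale1r addr0.
under eq_bigr => j _ do rewrite scalerA.
by rewrite -scaler_suml MNE eq_sym (negPf li) scale0r.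
Qed.

(** A linear change of variables over B keeps the extension of polynomial rings
    A[x] -> B[x] split. Used for k -> L, and again with these two polynomial rings
    as coefficients. *)
Lemma linear_retraction (A B : comNzRingType) (iota : {rmorphism A -> B})
    (pi : {additive B -> A}) (M N : 'M[B]_n) :
  retraction iota pi -> M *m N = 1%:M ->
  exists (J : {rmorphism {mpoly A[n]} -> {mpoly B[n]}})
    (Pi : {additive {mpoly B[n]} -> {mpoly A[n]}}),
  [/\ retraction J Pi, forall c, J c%:MP = (iota c)%:MP &
      forall i, J 'X_i = \sum_j M i j *: 'X_j].
Proof.
move=> ret MN1; exists (lin_subst M \o map_mpoly iota), (map_mpoly pi \o lin_subst N).
split=> [|c|i].
- apply: retraction_comp; first exact: retraction_map_mpoly.
  exact/retraction_cancel/lin_substK.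
- by rewrite /= map_mpolyC lin_substC.
- by rewrite /= map_mpolyX lin_substX.
Qed.

Lemma linear_chain_rule (A B : comNzRingType) (iota : {rmorphism A -> B})
    (J : {rmorphism {mpoly A[n]} -> {mpoly B[n]}}) (M N : 'M[B]_n) :
  M *m N = 1%:M -> (forall c, J c%:MP = (iota c)%:MP) ->
  (forall i, J 'X_i = \sum_j M i j *: 'X_j) ->
  forall i p, J p^`M(i) = \sum_j N j i *: (J p)^`M(j).
Proof.
move=> MN1 JC JX i p; have MNE := mulmx1E MN1.
have chain j : (J p)^`M(j) = \sum_l M l j *: J p^`M(l).
  elim/mpoly_ring_ind: p => [c|l|p q Ep Eq|p q Ep Eq].
  - by rewrite JC mderivC big1 // => l _; rewrite mderivC rmorph0 scaler0.
  - rewrite JX raddf_sum /= (bigD1 j) //= mderivZ mderivX1 eqxx big1 => [|m mj].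
      rewrite addr0 (bigD1 l) //= mderivX1 eqxx rmorph_nat big1 ?addr0 // => m ml.
      by rewrite mderivX1 eq_sym (negPf ml) rmorph0 scaler0.
    by rewrite mderivZ mderivX1 (negPf mj) scaler0.
  - rewrite rmorphD mderivD Ep Eq -big_split; apply: eq_bigr => l _ /=.
    by rewrite mderivD rmorphD scalerDr.
  - rewrite rmorphM mderivM Ep Eq mulr_suml mulr_sumr -big_split.
    apply: eq_bigr => l _ /=; rewrite mderivM rmorphD !rmorphM scalerDr.
    by rewrite scalerAl scalerAr.
under eq_bigr => j _ do rewrite chain scaler_sumr.
rewrite exchange_big /= (bigD1 i) //= [X in _ + X]big1 => [|l li].
  under eq_bigr => j _ do rewrite scalerA mulrC.
  by rewrite -scaler_suml MNE eqxx scale1r addr0.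
under eq_bigr => j _ do rewrite scalerA mulrC.
by rewrite -scaler_suml MNE (negPf li) scale0r.
Qed.

End LinearSubstitution.

(** The statement that al, be is a regular sequence amounts, in a domain, to the
    vanishing of a Koszul homology module, which depends only on the pencil
    spanned by al and be and not on the chosen basis. *)
Lemma pencil_syzygy (A : comNzRingType) (c : A) (al be l1 l2 a1 b1 a2 b2 p q : A) :
  GRing.rreg al -> (forall p q, p * be = q * al -> exists u, p = u * al) ->
  l1 = a1 * al + b1 * be -> l2 = a2 * al + b2 * be ->
  c * (a1 * b2 - a2 * b1) = 1 ->
  p * l2 = q * l1 -> exists u, p = u * l1.
Proof.
move=> al0 syz E1 E2 c1 Epq.
have E : (p * b2 - q * b1) * be = (q * a1 - p * a2) * al.
  have : p * l2 - q * l1 = 0 by rewrite Epq subrr.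
  rewrite E1 E2 => /eqP H; apply/eqP; rewrite -subr_eq0 -(eqP H); apply/eqP; ring.
have [r Er] := syz _ _ E.
have {E}Er' : q * a1 - p * a2 = r * be.
  by apply: al0; rewrite -E Er; ring.
exists (c * r).
have -> : p = c * (a1 * b2 - a2 * b1) * p by rewrite c1 mul1r.
have -> : c * (a1 * b2 - a2 * b1) * p =
  c * (a1 * (p * b2 - q * b1) + b1 * (q * a1 - p * a2)) by ring.
by rewrite Er Er' E1; ring.
Qed.

(** * Rees equations in eigencoordinates *)

(** The bilinear form t^T C x, written in coordinates that diagonalize C. *)
Lemma diag_bilinear n (L A : comNzRingType) (s : {rmorphism L -> A})
    (P C Q : 'M[L]_n) (d : 'rV[L]_n) (x t : 'I_n -> A) :
  P *m C *m Q = diag_mx d ->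
  \sum_i (\sum_r s ((C *m Q) i r) * x r) * (\sum_j s (P j i) * t j) =
  \sum_j s (d 0 j) * (x j * t j).
Proof.
move=> Ed; pose X := \col_j x j; pose Tr := \row_j t j.
transitivity (((Tr *m map_mx s P) *m (map_mx s (C *m Q) *m X)) 0 0).
  rewrite mxE; apply: eq_bigr => i _; rewrite !mxE mulrC; congr (_ * _).
    by apply: eq_bigr => j _; rewrite !mxE mulrC.
  by apply: eq_bigr => j _; rewrite !mxE.
rewrite mulmxA -[Tr *m _ *m _]mulmxA -map_mxM mulmxA Ed map_diag_mx mul_mx_diag.
by rewrite mxE; apply: eq_bigr => j _; rewrite !mxE; ring.
Qed.

Section Eigencoordinates.
Variables (k L : fieldType) (iota : {rmorphism k -> L}).
Local Notation Rk := {mpoly k[3]}.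
Local Notation RL := {mpoly L[3]}.
Local Notation Sk := {mpoly Rk[3]}.
Local Notation SL := {mpoly RL[3]}.

Variables (P Q : 'M[L]_3).
Hypothesis QP1 : Q *m P = 1%:M.

Variables (J : {rmorphism Rk -> RL}) (Jr : {additive RL -> Rk}).
Hypothesis J_ret : retraction J Jr.
Hypothesis JC : forall c, J c%:MP = (iota c)%:MP.
Hypothesis JX : forall i, J 'X_i = \sum_j Q i j *: 'X_j.

Variables (K : {rmorphism Sk -> SL}) (Kr : {additive SL -> Sk}).
Hypothesis K_ret : retraction K Kr.
Hypothesis KC : forall c, K c%:MP = (J c)%:MP.
Hypothesis KX : forall i, K 'X_i = \sum_j (P j i)%:MP *: 'X_j.

Variables (f : Rk) (kap : L).
Hypothesis kap0 : kap != 0.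
Hypothesis Jf : J f = kap *: ('X_0 * 'X_1 * 'X_2).

(** The components of the linear vector field C v, where v = (x, y, z). *)
Definition lin_field (C : 'M[k]_3) i : Rk := \sum_l C i l *: 'X_l.

(** The bilinear form sum_i (C v)_i T_i. It is an equation of the Rees algebra when
    the field C v annihilates f. *)
Definition lin_relation (C : 'M[k]_3) : Sk := \sum_i lin_field C i *: 'X_i.

Local Notation h j := (('X_0 * 'X_1 * 'X_2 : RL)^`M(j)).

Lemma grad_xyz : [/\ h 0 = 'X_1 * 'X_2, h 1 = 'X_0 * 'X_2 & h 2 = 'X_0 * 'X_1].
Proof. by split; rewrite !mderivM !mderivX1 /=; ring. Qed.

Lemma coord_change_grad i : J f^`M(i) = kap *: \sum_j P j i *: h j.
Proof.
rewrite (linear_chain_rule QP1 JC JX) Jf scaler_sumr.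
by apply: eq_bigr => j _; rewrite mderivZ !scalerA mulrC.
Qed.

Lemma coord_changeZ c p : J (c *: p) = iota c *: J p.
Proof. by rewrite -!mul_mpolyC rmorphM JC. Qed.

Lemma coord_change_lin_field C i :
  J (lin_field C i) = \sum_r (map_mx iota C *m Q) i r *: 'X_r.
Proof.
rewrite raddf_sum /=.
under eq_bigr => l _ do rewrite coord_changeZ JX scaler_sumr.
rewrite exchange_big; apply: eq_bigr => r _ /=.
rewrite mxE scaler_suml; apply: eq_bigr => l _.
by rewrite mxE scalerA.
Qed.

(** In eigencoordinates f is a multiple of x0 x1 x2, which the field d_j x_j d/dx_j
    multiplies by d_j; the d_j add up to the trace of C. *)
Lemma lin_field_eigen (C : 'M[k]_3) (d : 'rV[L]_3) :
  P *m map_mx iota C *m Q = diag_mx d ->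
  \sum_i lin_field C i * f^`M(i) = \tr C *: f.
Proof.
move=> Ed; apply: (can_inj (retractionK J_ret)).
rewrite raddf_sum coord_changeZ Jf /=.
transitivity (kap *: \sum_j (d 0 j)%:MP * ('X_j * h j)).
  rewrite -(diag_bilinear (@mpolyC 3 L) _ _ Ed) scaler_sumr.
  apply: eq_bigr => i _; rewrite rmorphM coord_change_lin_field coord_change_grad -scalerAr.
  by congr (_ *: (_ * _)); apply: eq_bigr => j _; rewrite mul_mpolyC.
have -> : iota (\tr C) = d 0 0 + d 0 1 + d 0 2.
  rewrite -sum_ord3 -mxtrace_diag -Ed -mxtrace_mulC mulmxA QP1 mul1mx.
  by rewrite raddf_sum; apply: eq_bigr => i _; rewrite mxE.
have [h0 h1 h2] := grad_xyz; rewrite sum_ord3 h0 h1 h2 -!mul_mpolyC !mpolyCD.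
ring.
Qed.

Local Notation w i := (nvar L i * 'X_i : SL).

Lemma coord_change_lin_relation (C : 'M[k]_3) (d : 'rV[L]_3) :
  P *m map_mx iota C *m Q = diag_mx d ->
  K (lin_relation C) = \sum_j nconst (d 0 j) * w j.
Proof.
move=> Ed; pose s : {rmorphism L -> SL} := @mpolyC 3 RL \o @mpolyC 3 L.
rewrite -(diag_bilinear s _ _ Ed) raddf_sum; apply: eq_bigr => i _.
rewrite -mul_mpolyC [LHS](rmorphM K) KC KX coord_change_lin_field; congr (_ * _).
  rewrite raddf_sum; apply: eq_bigr => r _ /=.
  by rewrite nvar.unlock -mul_mpolyC mpolyCM.
by apply: eq_bigr => j _; rewrite /= mul_mpolyC.
Qed.

Local Notation g := (fun i => f^`M(i)).

(** The substitution K, followed by the map of [toric_kernel], factors through the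
    Rees algebra of the gradient of f, because in eigencoordinates this gradient is
    proportional to that of x0 x1 x2; the factor kap is absorbed in t. *)
Lemma coord_change_kernel p : rees_eval g p = 0 ->
  exists u v, K p = u * (w 0 - w 1) + v * (w 1 - w 2).
Proof.
move=> p0; have [h0 h1 h2] := grad_xyz.
pose H (i : 'I_3) : SL := (h i)%:MP * 'X_0.
pose F : {rmorphism SL -> SL} := mmap (@mpolyC 3 RL) H.
have FC c : F c%:MP = c%:MP by apply: mmapC.
have FX i : F 'X_i = H i by rewrite /F /= mmapX mmap1U.
have HE (i a b : 'I_3) : h i = 'X_a * 'X_b -> F 'X_i = nvar L a * nvar L b * 'X_0.
  by move=> hi; rewrite FX /H hi mpolyCM nvar.unlock.
apply: (toric_kernel FC (HE 0 1 2 h0) (HE 1 0 2 h1) (HE 2 0 1 h2)).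
(* where t goes: the gradient of f is kap times that of x0 x1 x2 *)
pose t0 : SL := (kap^-1)%:MP%:MP * 'X_0.
have [th [thC thX]] : exists th : {rmorphism {poly Rk} -> SL},
    (forall c, th c%:P = (J c)%:MP) /\ th 'X = t0.
  exists (horner_eval t0 \o map_poly (@mpolyC 3 RL \o J)).
  split=> [c|]; rewrite /= ?map_polyC ?map_polyX /horner_eval ?hornerX //.
  by rewrite hornerC.
have thE : F \o K =1 th \o rees_eval g.
  apply: (mpoly_rmorph_eq (F := F \o K) (G := th \o rees_eval g)) => [c|i] /=.
    by rewrite KC FC rees_evalC thC.
  rewrite KX raddf_sum rees_evalX -mul_polyC [RHS](rmorphM th) thC thX coord_change_grad.
  transitivity (\sum_j ((P j i)%:MP * h j)%:MP * 'X_0 : SL).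
    apply: eq_bigr => j _.
    by rewrite -mul_mpolyC [LHS](rmorphM F) FC FX /H mulrA -mpolyCM.
  rewrite -mulr_suml /t0 mulrA; congr (_ * _).
  rewrite -mpolyCM -raddf_sum; congr (_%:MP).
  rewrite [RHS]mulrC mul_mpolyC scalerA mulVf // scale1r.
  by apply: eq_bigr => j _; rewrite mul_mpolyC.
by have := thE p; rewrite /= p0 (rmorph0 th).
Qed.

Variables (C1 C2 : 'M[k]_3) (d1 d2 : 'rV[L]_3).
Hypothesis Ed1 : P *m map_mx iota C1 *m Q = diag_mx d1.
Hypothesis Ed2 : P *m map_mx iota C2 *m Q = diag_mx d2.
Hypothesis tr1 : \tr C1 = 0.
Hypothesis tr2 : \tr C2 = 0.
Hypothesis indep : d1 0 0 * d2 0 1 - d2 0 0 * d1 0 1 != 0.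

Local Notation l1 := (lin_relation C1).
Local Notation l2 := (lin_relation C2).
Local Notation al := (w 0 - w 1).
Local Notation be := (w 1 - w 2).
Let s : {rmorphism L -> SL} := @mpolyC 3 RL \o @mpolyC 3 L.

(** With d_0 + d_1 + d_2 = 0, the form sum_j d_j w_j lies in the pencil
    spanned by w_0 - w_1 and w_1 - w_2. *)
Lemma coord_change_traceless (C : 'M[k]_3) (d : 'rV[L]_3) :
  P *m map_mx iota C *m Q = diag_mx d -> \tr C = 0 ->
  K (lin_relation C) = s (d 0 0) * al + s (d 0 0 + d 0 1) * be.
Proof.
move=> Ed trC; rewrite (coord_change_lin_relation Ed) sum_ord3.
have -> : d 0 2 = - (d 0 0 + d 0 1).
  apply/eqP; rewrite -addr_eq0 addrC -sum_ord3 -mxtrace_diag -Ed.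
  rewrite -mxtrace_mulC mulmxA QP1 mul1mx.
  have -> : \tr (map_mx iota C) = iota (\tr C).
    by rewrite raddf_sum; apply: eq_bigr => i _; rewrite mxE.
  by rewrite trC rmorph0.
have sN a b : nconst (- (a + b)) = - (s a + s b).
  by rewrite /s /= /nconst mpolyCN mpolyCN !mpolyCD.
have sD a b : s (a + b) = s a + s b by apply: rmorphD.
have nE c : nconst c = s c by [].
rewrite sN sD !nE.
move: (w 0) (w 1) (w 2) (s _) (s _) => w0 w1 w2 a b; ring.
Qed.

Let dt := d1 0 0 * d2 0 1 - d2 0 0 * d1 0 1.

Lemma traceless_pencil_det : s dt^-1 *
  (s (d1 0 0) * s (d2 0 0 + d2 0 1) - s (d2 0 0) * s (d1 0 0 + d1 0 1)) = 1.
Proof.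
rewrite -!(rmorphM s) -(rmorphB s) -(rmorphM s) -(rmorph1 s); congr (s _).
have -> : d1 0 0 * (d2 0 0 + d2 0 1) - d2 0 0 * (d1 0 0 + d1 0 1) = dt.
  by rewrite /dt; ring.
by rewrite mulVf.
Qed.

(** Over L two independent traceless diagonal fields span the pencil of
    [coord_change_kernel]; the retraction brings the coefficients back to k. *)
Lemma diagonalizable_rees_kernel p : rees_eval g p = 0 -> exists u v, p = u * l1 + v * l2.
Proof.
move=> /coord_change_kernel[u [v Ep]].
have E1 := coord_change_traceless Ed1 tr1; have E2 := coord_change_traceless Ed2 tr2; have D := traceless_pencil_det.
pose u' := s dt^-1 * (s (d2 0 0 + d2 0 1) * u - s (d2 0 0) * v).
pose v' := s dt^-1 * (s (d1 0 0) * v - s (d1 0 0 + d1 0 1) * u).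
have Kp : K p = u' * K l1 + v' * K l2.
  rewrite Ep E1 E2 /u' /v' -[in LHS](mul1r u) -[in LHS](mul1r v) -D.
  move: (w 0) (w 1) (w 2) (s (d1 0 0)) (s (d1 0 0 + _)) (s (d2 0 0))
    (s (d2 0 0 + _)) (s _) => w0 w1 w2 a b c d e; ring.
by exists (Kr u'), (Kr v'); apply: retraction_comb2 K_ret Kp.
Qed.

Lemma lin_relation_kernel (C : 'M[k]_3) (d : 'rV[L]_3) :
  P *m map_mx iota C *m Q = diag_mx d -> \tr C = 0 ->
  rees_eval g (lin_relation C) = 0.
Proof.
move=> Ed trC; rewrite rees_eval_form.
by rewrite (lin_field_eigen Ed) trC !scale0r.
Qed.

Lemma diagonalizable_relation_syzygy p q : p * l2 = q * l1 -> exists u, p = u * l1.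
Proof.
move=> Epq; have E1 := coord_change_traceless Ed1 tr1; have E2 := coord_change_traceless Ed2 tr2.
have al0 : al != 0.
  apply/eqP => E0; have := congr1 (fun q : SL =>
    meval (fun=> 1) (meval (fun i : 'I_3 => (i == 0)%:R) q)) E0.
  rewrite !meval0 mevalB !mevalM !mevalXU nvar.unlock !mevalC /=.
  by rewrite mulr0 subr0 mulr1 mevalXU => /eqP; rewrite oner_eq0.
have al_reg : GRing.rreg al.
  by move=> a b; rewrite ![_ * al]mulrC; apply: (mpoly_lreg al0).
have Kpq : K p * K l2 = K q * K l1 by rewrite -!(rmorphM K) Epq.
have syz : forall p q : SL, p * be = q * al -> exists u, p = u * al.
  exact: toric_syzygy.
have [u Ep] := @pencil_syzygy SL (s dt^-1) al be (K l1) (K l2) (s (d1 0 0))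
  (s (d1 0 0 + d1 0 1)) (s (d2 0 0)) (s (d2 0 0 + d2 0 1)) (K p) (K q)
  al_reg syz E1 E2 traceless_pencil_det Kpq.
by exists (Kr u); apply: retraction_comb1 K_ret Ep.
Qed.

End Eigencoordinates.

(** * Separability of the characteristic polynomial *)

Lemma det_mx33 (A : comNzRingType) (M : 'M[A]_3) :
  \det M = M 0 0 * (M 1 1 * M 2 2 - M 1 2 * M 2 1)
         - M 0 1 * (M 1 0 * M 2 2 - M 1 2 * M 2 0)
         + M 0 2 * (M 1 0 * M 2 1 - M 1 1 * M 2 0).
Proof.
pose m (i j : nat) := M (inord i) (inord j).
have inord3 (i : 'I_3) : inord i = i by apply: inord_val.
have mE (i j : 'I_3) : M i j = m i j by rewrite /m !inord3.
rewrite (expand_det_row _ 0) !big_ord_recl big_ord0 /cofactor.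
do 3!rewrite (expand_det_row _ 0) !big_ord_recl !big_ord0 /cofactor !det_mx11.
by rewrite !mxE !mE /= /bump /=; ring.
Qed.

Lemma diagonalization (L : fieldType) n (A : 'M[L]_n.+1) rs :
  separable_poly (char_poly A) -> char_poly A = \prod_(r <- rs) ('X - r%:P) ->
  exists (P Q : 'M[L]_n.+1) (d : 'rV[L]_n.+1),
  [/\ Q *m P = 1%:M, P *m A *m Q = diag_mx d & injective (d 0)].
Proof.
move=> sepA EA.
have urs : uniq rs by rewrite -separable_prod_XsubC -EA.
have /diagonalizableP[P uP /diagonalizable_forPex[d]] :
    exists2 rs, uniq rs & mxminpoly A %| \prod_(x <- rs) ('X - x%:P).
  by exists rs; rewrite // -EA mxminpoly_dvd_char.
move=> /(simmxP uP) Ed.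
have QP : invmx P *m P = 1%:M by apply: mulVmx.
have PQ : P *m invmx P = 1%:M by apply: mulmxV.
exists P, (invmx P), d; split=> //; first by rewrite Ed -mulmxA PQ mulmx1.
have charD : char_poly (diag_mx d) = char_poly A.
  have -> : diag_mx d = P *m A *m invmx P by rewrite Ed -mulmxA PQ mulmx1.
  rewrite /char_poly /char_poly_mx !map_mxM.
  have PQp : map_mx polyC P *m map_mx polyC (invmx P) = 1%:M.
    by rewrite -map_mxM PQ map_mx1.
  have -> : 'X%:M - map_mx polyC P *m map_mx polyC A *m map_mx polyC (invmx P) =
     map_mx polyC P *m ('X%:M - map_mx polyC A) *m map_mx polyC (invmx P).
    rewrite mulmxBr mulmxBl; congr (_ - _).
    by rewrite scalar_mxC -mulmxA PQp mulmx1.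
  by rewrite !det_mulmx mulrAC -det_mulmx PQp det1 mul1r.
have : separable_poly (\prod_(i < n.+1) ('X - (d 0 i)%:P)).
  rewrite -charD char_poly_trig ?diag_mx_is_trig // in sepA.
  rewrite (eq_bigr (fun i => 'X - (diag_mx d i i)%:P)) // => i _.
  by rewrite mxE eqxx mulr1n.
rewrite -big_enum -(big_map (d 0) xpredT (fun r => 'X - r%:P)).
by rewrite separable_prod_XsubC => /injectiveP.
Qed.

Lemma pchar0_natr_neq0 (k : fieldType) n :
  [pchar k] =i pred0 -> (n.+1%:R : k) != 0.
Proof. by move/pcharf0P->. Qed.

(** A nonseparable cubic is divisible by the square of a linear form over k itself:
    in characteristic 0 it has a nonconstant square factor, whose root can only be
    linear for reasons of degree. *)
Lemma nonseparable_cubic (k : fieldType) (p : {poly k}) :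
  [pchar k] =i pred0 -> p \is monic -> size p = 4%N -> ~~ separable_poly p ->
  exists a b, p = ('X - a%:P) ^+ 2 * ('X - b%:P).
Proof.
move=> chk mon_p size_p nsep.
have p0 : p != 0 by rewrite -size_poly_eq0 size_p.
have [u u1 u2p] : exists2 u : {poly k}, size u != 1%N & u ^+ 2 %| p.
  apply: contrapT => none; case/negP: nsep; apply/separable_polyP; split.
    apply/poly_square_freeP => u u1; apply/negP => u2p.
    by apply: none; exists u.
  move=> u _ u_gt1; apply/eqP => /(congr1 (fun q : {poly k} => q`_(size u).-2)).
  rewrite coef_deriv coef0 => /eqP.
  have -> : (size u).-2.+1 = (size u).-1 by case: (size u) u_gt1 => [|[]].
  rewrite -mulr_natr mulf_eq0 -lead_coefE lead_coef_eq0 -size_poly_eq0.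
  case: (size u) u_gt1 => [|[|m]] //= _.
  by rewrite (negPf (pchar0_natr_neq0 _ chk)).
have u0 : u != 0.
  by apply: contraNneq p0 => u0; move: u2p; rewrite u0 expr0n dvd0p.
have size_u : size u = 2%N.
  have := dvdp_leq p0 u2p; rewrite size_p expr2 size_mul //.
  by move: u1 u0; rewrite -size_poly_eq0; case: (size u) => [|[|[|m]]] // _ _; rewrite !addnS !addSn.
have [a ua] : exists a, root u a.
  by have [a] := @poly2_root _ u size_u; exists a.
have a2p : ('X - a%:P) ^+ 2 %| p.
  by apply: dvdp_trans u2p; rewrite dvdp_exp2r // dvdp_XsubCl.
have [q Eq] := dvdpP _ _ a2p.
have mon2 : ('X - a%:P) ^+ 2 \is monic by rewrite monic_exp ?monicXsubC.
have mon_q : q \is monic by move: mon_p; rewrite Eq monicMr.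
have size_q : size q = 2%N.
  have := size_p; rewrite Eq size_Mmonic ?monic_neq0 // size_exp_XsubC.
  by rewrite addn3 /= => -[].
exists a, (- q`_0); rewrite Eq mulrC; congr (_ * _).
apply/polyP => i; rewrite coefB coefX coefC.
have q1 : q`_1 = 1 by move/monicP: mon_q; rewrite lead_coefE size_q.
case: i => [|[|i]] /=; rewrite ?subr0 ?sub0r ?opprK ?q1 //.
by rewrite nth_default // size_q.
Qed.

Section LinearFields.
Variable k : fieldType.
Implicit Types C D : 'M[k]_3.

Lemma lin_fieldD C D i : lin_field (C + D) i = lin_field C i + lin_field D i.
Proof.
by rewrite -big_split; apply: eq_bigr => l _; rewrite mxE scalerDl.
Qed.

Lemma lin_fieldZ a C i : lin_field (a *: C) i = a *: lin_field C i.
Proof. by rewrite scaler_sumr; apply: eq_bigr => l _; rewrite mxE scalerA. Qed.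

Lemma lin_field1 i : lin_field (1%:M : 'M[k]_3) i = 'X_i.
Proof.
rewrite /lin_field (bigD1 i) //= mxE eqxx scale1r big1 ?addr0 // => l li.
by rewrite mxE eq_sym (negPf li) scale0r.
Qed.

Lemma lin_field_row (w : 'rV[k]_3) C :
  \sum_i w 0 i *: lin_field C i = \sum_l (w *m C) 0 l *: 'X_l.
Proof.
under eq_bigr => i _ do rewrite scaler_sumr.
rewrite exchange_big; apply: eq_bigr => l _ /=.
by rewrite mxE scaler_suml; apply: eq_bigr => i _; rewrite scalerA.
Qed.

(** The matrix with columns v, C v and C^2 v. *)
Definition krylov C : 'M[{mpoly k[3]}]_3 :=
  \matrix_(i, j) [:: 'X_i; lin_field C i; lin_field (C *m C) i]`_j.

(** Column operations: (C + a) v and (C + a)^2 v differ from C v and C^2 v by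
    combinations of the preceding columns. *)
Lemma det_krylov_shift C a : \det (krylov (C + a%:M)) = \det (krylov C).
Proof.
have E1 i : lin_field (C + a%:M) i = lin_field C i + a%:MP * 'X_i.
  by rewrite lin_fieldD -scalemx1 lin_fieldZ lin_field1 mul_mpolyC.
have E2 i : lin_field ((C + a%:M) *m (C + a%:M)) i =
    lin_field (C *m C) i + a%:MP * lin_field C i * 2 + a%:MP ^+ 2 * 'X_i.
  rewrite mulmxDr mulmxDl mul_scalar_mx mul_mx_scalar !lin_fieldD !lin_fieldZ E1.
  by rewrite -!mul_mpolyC; ring.
by rewrite !det_mx33 !mxE /= !E1 !E2; ring.
Qed.

(** Shift C to B, with characteristic polynomial X^2 (X - c). If B (B - c) were 0, the
    last two columns would be proportional. So a row of B - c gives u with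
    w = u B nonzero and w B = 0. Multiplying the matrix on the left by a matrix P with
    first rows w and u makes its first two rows (w v, 0, 0) and (u v, w v, 0), and
    W = w v appears squared in the determinant. *)
Lemma krylov_double_eigenvalue C a b :
  char_poly C = ('X - a%:P) ^+ 2 * ('X - b%:P) -> \det (krylov C) != 0 ->
  exists (W h : {mpoly k[3]}), W.@[fun=> 0] = 0 /\ \det (krylov C) = W ^+ 2 * h.
Proof.
move=> charC; have [B BE] : exists B, B = C - a%:M by exists (C - a%:M).
have -> : C = B + a%:M by rewrite BE subrK.
pose c := b - a; pose N := B *m (B - c%:M).
rewrite det_krylov_shift => det0.
have BN : B *m N = 0.
  have := Cayley_Hamilton C; rewrite charC rmorphM rmorphXn !rmorphB /=.
  rewrite horner_mx_X !horner_mx_C expr2 => CH.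
  rewrite /N /c mulmxA; have -> : B - (b - a)%:M = C - b%:M.
    by rewrite BE raddfB opprB addrA subrK.
  by rewrite BE; exact: CH.
have comm : (B - c%:M) *m B = N.
  by rewrite /N mulmxBl mulmxBr mul_mx_scalar mul_scalar_mx.
have NB : N *m B = 0 by rewrite /N -mulmxA comm.
have [i Ni] : exists i, row i N != 0.
  apply: contrapT => Nz; case/eqP: det0.
  have N0 : N = 0.
    apply/row_matrixP => i; rewrite row0; apply: contrapT => /eqP Ni.
    by apply: Nz; exists i.
  have EB i : lin_field (B *m B) i = c%:MP * lin_field B i.
    have -> : B *m B = c *: B.
      by apply/eqP; rewrite -subr_eq0 -mul_mx_scalar -mulmxBr; apply/eqP.
    by rewrite lin_fieldZ mul_mpolyC.
  by rewrite det_mx33 !mxE /= !EB; ring.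
have [w [u [wB uB w0]]] : exists w u : 'rV[k]_3,
    [/\ w *m B = 0, u *m B = w & w != 0].
  exists (row i N), (row i (B - c%:M)); split=> //.
    by rewrite -row_mul NB row0.
  by rewrite -row_mul comm.
pose form (r : 'rV[k]_3) : {mpoly k[3]} := \sum_l r 0 l *: 'X_l.
have [P [Pw Pu detP]] : exists P : 'M[k]_3,
    [/\ row 0 P = w, row 1 P = u & \det P != 0].
  pose P j := \matrix_(l < 3) [:: w; u; delta_mx 0 j]`_l : 'M[k]_3.
  suff [j dj] : exists j, \det (P j) != 0.
    by exists (P j); split=> //; apply/rowP => l; rewrite !mxE.
  apply: contrapT => Pz; have {}Pz j : \det (P j) = 0.
    by apply: contrapT => /eqP dj; apply: Pz; exists j.
  (* if all the minors of the rows w and u vanish, they are proportional *)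
  have cross : forall l m, w 0 l * u 0 m = w 0 m * u 0 l.
    have := Pz 0; have := Pz 1; have := Pz 2.
    rewrite !det_mx33 !mxE /= => z2 z1 z0.
    have E01 : w 0 0 * u 0 1 = w 0 1 * u 0 0.
      by apply/eqP; rewrite -subr_eq0 -z2; apply/eqP; ring.
    have E02 : w 0 2 * u 0 0 = w 0 0 * u 0 2.
      by apply/eqP; rewrite -subr_eq0 -z1; apply/eqP; ring.
    have E12 : w 0 1 * u 0 2 = w 0 2 * u 0 1.
      by apply/eqP; rewrite -subr_eq0 -z0; apply/eqP; ring.
    by elim/ord3P; elim/ord3P.
  case/eqP: w0; apply/rowP => l; rewrite [RHS]mxE.
  have ww : w 0 l * w 0 l = 0.
    rewrite -{2}uB mxE mulr_sumr.
    under eq_bigr => m _ do rewrite mulrA cross mulrAC.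
    rewrite -mulr_suml; have := congr1 (fun r : 'rV_3 => r 0 l) wB.
    by rewrite !mxE => ->; rewrite mul0r.
  by apply/eqP; have /eqP := ww; rewrite mulf_eq0 orbb.
pose M := map_mx (@mpolyC 3 k) P *m krylov B.
have ME r s C' : (forall l, krylov B l s = lin_field C' l) ->
    M r s = form (row r P *m C').
  move=> KE; rewrite /form -lin_field_row mxE; apply: eq_bigr => l _.
  by rewrite !mxE mul_mpolyC -KE mxE.
have M0 r : M r 0 = form (row r P).
  by rewrite (ME r 0 1%:M) ?mulmx1 // => l; rewrite mxE lin_field1.
have M1 r : M r 1 = form (row r P *m B) by apply: ME => l; rewrite mxE.
have M2 r : M r 2 = form (row r P *m (B *m B)) by apply: ME => l; rewrite mxE.
have form0 : form 0 = 0.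
  by rewrite /form big1 // => l _; rewrite mxE scale0r.
have detM : \det M = form w ^+ 2 * M 2 2.
  rewrite det_mx33 !M0 !M1 (M2 0) (M2 1) Pw Pu !mulmxA uB wB mul0mx form0.
  by ring.
exists (form w), ((\det P)^-1 *: M 2 2); split.
  rewrite /form raddf_sum big1 // => l _.
  by rewrite /= mevalZ mevalXU mulr0.
rewrite -scalerAr -detM det_mulmx det_map_mx mul_mpolyC scalerA mulVf //.
by rewrite scale1r.
Qed.

End LinearFields.

Section Reducedness.
Variables (k : fieldType) (C : 'M[k]_3) (f : {mpoly k[3]}) (e : k).
Hypothesis char_k : [pchar k] =i pred0.
Hypothesis fE : f = e *: \det (krylov C).
Hypothesis f0 : f != 0.

(** If f = W^2 h with W a linear form, then W h is nilpotent modulo f, but not 0. *)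
Lemma reduced_separable : reduced f -> separable_poly (char_poly C).
Proof.
move=> red; apply: contrapT => /negP nsep.
have e0 : e != 0 by apply: contraNneq f0 => e0; rewrite fE e0 scale0r.
have det0 : \det (krylov C) != 0.
  by apply: contraNneq f0 => det0; rewrite fE det0 scaler0.
have size_char : size (char_poly C) = 4%N by rewrite size_char_poly.
have [a [b charC]] :=
  nonseparable_cubic char_k (char_poly_monic C) size_char nsep.
have [W [h [W0 detE]]] := krylov_double_eigenvalue charC det0.
pose h' := e *: h; have fW : f = W ^+ 2 * h' by rewrite fE detE scalerAr.
have sq : principal f ((W * h') ^+ 2).
  by apply/principalP; exists h'; rewrite fW; ring.
have /principalP[q Eq] := red _ _ sq.
have nz : W * h' != 0.
  by apply: contraNneq f0 => z; rewrite fW expr2 -mulrA z mulr0.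
have qW : 1 = q * W.
  by apply: (mulIf nz); rewrite mul1r {1}Eq fW; ring.
have := congr1 (meval (fun=> 0)) qW.
by rewrite meval1 mevalM W0 mulr0 => /eqP; rewrite oner_eq0.
Qed.

End Reducedness.

(** * The cubic attached to a separable matrix *)

(** The minor that decides whether the traceless parts of diag (a, b, c) and of its
    square are independent is a third of a Vandermonde determinant. *)
Lemma traceless_minor (L : comNzRingType) (a b c m1 m2 : L) :
  m1 * 3%:R = a + b + c -> m2 * 3%:R = a ^+ 2 + b ^+ 2 + c ^+ 2 ->
  (b - a) * (c - a) * (c - b) =
  3%:R * ((a - m1) * (b ^+ 2 - m2) - (a ^+ 2 - m2) * (b - m1)).
Proof.
move=> E1 E2.
transitivity (3%:R * a * b * (b - a) + (b - a) * (m2 * 3%:R) -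
    (b - a) * (a + b) * (m1 * 3%:R)); last by ring.
by rewrite E1 E2; ring.
Qed.

Section KrylovCubic.
Variables (k : fieldType) (C : 'M[k]_3) (e : k).
Hypothesis char_k : [pchar k] =i pred0.
Let f : {mpoly k[3]} := e *: \det (krylov C).
Hypothesis f0 : f != 0.
Hypothesis red_f : reduced f.

Local Notation g := (fun i => f^`M(i)).

Definition traceless (D : 'M[k]_3) : 'M[k]_3 := D - (\tr D / 3%:R)%:M.

Lemma three_neq0 : 3%:R != 0 :> k.
Proof. exact: pchar0_natr_neq0. Qed.

Lemma traceless_tr D : \tr (traceless D) = 0.
Proof.
rewrite raddfB /= mxtrace_scalar -[X in _ - X]mulr_natr divfK ?subrr //.
exact: three_neq0.
Qed.

Local Notation l1 := (lin_relation (traceless C)).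
Local Notation l2 := (lin_relation (traceless (C *m C))).

(** All that is needed about the cubic, stated over k but proved over a
    splitting field of the characteristic polynomial of C: how the fields v, C v
    and C^2 v act on f, and that the equations l1, l2 of the Rees algebra generate all
    the others and form a regular sequence. *)
Lemma krylov_cubic_facts :
  [/\ forall D, D \in [:: 1%:M; C; C *m C] ->
        \sum_i lin_field D i * f^`M(i) = \tr D *: f,
      rees_eval g l1 = 0 /\ rees_eval g l2 = 0,
      forall p, rees_eval g p = 0 -> exists u v, p = u * l1 + v * l2 &
      forall p q, p * l2 = q * l1 -> exists u, p = u * l1].
Proof.
have e0 : e != 0 by apply: contraNneq f0 => e0; rewrite /f e0 scale0r.
have sepC := reduced_separable char_k (erefl f) f0 red_f.
have char0 : char_poly C != 0 by apply/monic_neq0/char_poly_monic.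
have [L [iota [pi [rs [ret charE]]]]] := splitting_field_retraction char0.
rewrite (monicP (char_poly_monic C)) rmorph1 scale1r map_char_poly in charE.
have sepL : separable_poly (char_poly (map_mx iota C)).
  by rewrite -map_char_poly separable_map.
have [P [Q [d [QP Ed inj_d]]]] := diagonalization sepL charE.
have PQ : P *m Q = 1%:M by apply: mulmx1C.
have [J [Jr [J_ret JC JX]]] := linear_retraction ret QP.
have QPt : (map_mx (@mpolyC 3 L) P)^T *m (map_mx (@mpolyC 3 L) Q)^T = 1%:M.
  by rewrite -trmx_mul -map_mxM QP map_mx1 trmx1.
have [K [Kr [K_ret KC KX0]]] := linear_retraction J_ret QPt.
have KX i : K 'X_i = \sum_j (P j i)%:MP *: 'X_j.
  by rewrite KX0; apply: eq_bigr => j _; rewrite !mxE.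
have Ed2 : P *m map_mx iota (C *m C) *m Q = diag_mx (\row_j (d 0 j) ^+ 2).
  have -> : P *m map_mx iota (C *m C) *m Q =
      (P *m map_mx iota C *m Q) *m (P *m map_mx iota C *m Q).
    by rewrite map_mxM !mulmxA -(mulmxA _ Q P) QP mulmx1.
  by rewrite Ed mulmx_diag; congr diag_mx; apply/rowP => j; rewrite !mxE expr2.
have Ed0 : P *m map_mx iota 1%:M *m Q = diag_mx (const_mx 1).
  by rewrite map_mx1 mulmx1 PQ diag_const_mx.
pose V := (d 0 1 - d 0 0) * (d 0 2 - d 0 0) * (d 0 2 - d 0 1).
have V0 : V != 0.
  have dn i j : i != j -> d 0 i - d 0 j != 0.
    by move=> ij; rewrite subr_eq0 (inj_eq inj_d).
  by rewrite /V !mulf_neq0 // dn.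
(* the factor relating f to x0 x1 x2; V is a Vandermonde determinant *)
pose kap := iota e * (\det Q * V).
have kap0 : kap != 0.
  have [_] := mulmx1_unit PQ; rewrite unitmxE unitfE => detQ.
  by apply: mulf_neq0; [rewrite fmorph_eq0 | apply: mulf_neq0].
have QE (D : 'M[k]_3) (dD : 'rV[L]_3) i r :
    P *m map_mx iota D *m Q = diag_mx dD ->
  (map_mx iota D *m Q) i r = Q i r * dD 0 r.
  move=> ED; have -> : map_mx iota D *m Q = Q *m diag_mx dD.
    by rewrite -ED !mulmxA QP mul1mx.
  by rewrite mul_mx_diag mxE.
have Jf : J f = kap *: ('X_0 * 'X_1 * 'X_2).
  pose N : 'M[{mpoly L[3]}]_3 := \matrix_(r, c)
    [:: 'X_r; (d 0 r)%:MP * 'X_r; (d 0 r ^+ 2)%:MP * 'X_r]`_c.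
  have JK : map_mx J (krylov C) = map_mx (@mpolyC 3 L) Q *m N.
    apply/matrixP => i j; rewrite !mxE; elim/ord3P: j => /=.
    - by rewrite JX; apply: eq_bigr => r _; rewrite !mxE mul_mpolyC.
    - rewrite (coord_change_lin_field JC JX); apply: eq_bigr => r _.
      by rewrite (QE _ _ _ _ Ed) !mxE /= mulrA -mpolyCM mul_mpolyC.
    - rewrite (coord_change_lin_field JC JX); apply: eq_bigr => r _.
      by rewrite (QE _ _ _ _ Ed2) !mxE /= mulrA -mpolyCM mul_mpolyC.
  rewrite /f (coord_changeZ JC) -det_map_mx JK det_mulmx det_map_mx.
  rewrite [\det N]det_mx33 !mxE /= /kap /V -!mul_mpolyC !(mpolyCM, mpolyCB).
  by ring.
have tEd (D : 'M[k]_3) (dD : 'rV[L]_3) :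
    P *m map_mx iota D *m Q = diag_mx dD ->
  P *m map_mx iota (traceless D) *m Q =
    diag_mx (dD - const_mx (iota (\tr D / 3%:R))).
  move=> ED; rewrite map_mxB map_scalar_mx mulmxBr mulmxBl ED.
  rewrite mul_mx_scalar -scalemxAl PQ scalemx1 raddfB /=.
  by rewrite diag_const_mx.
have T1 := tEd _ _ Ed; have T2 := tEd _ _ Ed2.
have trE (D : 'M[k]_3) (dD : 'rV[L]_3) :
    P *m map_mx iota D *m Q = diag_mx dD ->
  iota (\tr D / 3%:R) * 3%:R = dD 0 0 + dD 0 1 + dD 0 2.
  move=> ED; rewrite -(rmorph_nat iota 3) -rmorphM divfK ?three_neq0 //.
  rewrite -sum_ord3 -mxtrace_diag -ED -mxtrace_mulC mulmxA QP mul1mx.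
  by rewrite raddf_sum; apply: eq_bigr => i _; rewrite mxE.
have indep : (d - const_mx (iota (\tr C / 3%:R))) 0 0 *
    ((\row_j (d 0 j) ^+ 2) - const_mx (iota (\tr (C *m C) / 3%:R))) 0 1 -
    ((\row_j (d 0 j) ^+ 2) - const_mx (iota (\tr (C *m C) / 3%:R))) 0 0 *
    (d - const_mx (iota (\tr C / 3%:R))) 0 1 != 0.
  have := trE _ _ Ed; have := trE _ _ Ed2; rewrite !mxE.
  move: (iota _) (iota _) => m1 m2 E2 E1.
  apply: contraNneq V0 => H.
  by rewrite /V (traceless_minor E1 E2) H mulr0.
split.
- move=> D; rewrite !inE => /or3P[]/eqP->.
  + exact: (lin_field_eigen QP J_ret JC JX Jf Ed0).
  + exact: (lin_field_eigen QP J_ret JC JX Jf Ed).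
  + exact: (lin_field_eigen QP J_ret JC JX Jf Ed2).
- split.
    exact: (lin_relation_kernel QP J_ret JC JX Jf T1 (traceless_tr _)).
  exact: (lin_relation_kernel QP J_ret JC JX Jf T2 (traceless_tr _)).
- move=> p; exact: (diagonalizable_rees_kernel QP JC JX K_ret KC KX kap0 Jf T1 T2
    (traceless_tr _) (traceless_tr _) indep).
- move=> p q; exact: (diagonalizable_relation_syzygy QP JC JX K_ret KC KX T1 T2
    (traceless_tr _) (traceless_tr _) indep).
Qed.

End KrylovCubic.


(** * Logarithmic derivations *)

Section QuotientModules.
Local Open Scope quotient_scope.

Lemma quot_lmod_piZ (A : comNzRingType) (V : lmodType A) (N : submod V) a (v : V) :
  \pi_(quot_lmod N) (a *: v) = a *: (\pi_(quot_lmod N) v : quot_lmod N).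
Proof. by rewrite -quot_scale_pi. Qed.

Lemma quot_lmod_pi_sum (A : comNzRingType) (V : lmodType A) (N : submod V) m
    (a : 'I_m -> A) (v : 'I_m -> V) :
  \pi_(quot_lmod N) (\sum_j a j *: v j) =
  \sum_j a j *: (\pi_(quot_lmod N) (v j) : quot_lmod N).
Proof.
have pi0 : \pi_(quot_lmod N) 0 = 0 :> quot_lmod N.
  by rewrite -(scale0r 0) quot_lmod_piZ scale0r.
by rewrite (big_morph _ (quot_piD N) pi0); apply: eq_bigr => j _;
  rewrite quot_lmod_piZ.
Qed.

End QuotientModules.

Section PolynomialDerivations.
Variables (k : fieldType) (n : nat).
Local Notation R := {mpoly k[n]}.

Lemma der_sumE (I : Type) (r : seq I) (th : I -> derivation R) p :
  (\sum_(i <- r) th i) p = \sum_(i <- r) th i p.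
Proof.
elim: r => [|i r IHr]; first by rewrite !big_nil.
by rewrite !big_cons der_addE IHr.
Qed.

Lemma der_eq_vars (th et : derivation R) : (forall i, th 'X_i = et 'X_i) -> th = et.
Proof.
move=> E; apply: derP.
have der1 (d : derivation R) c : d c%:MP = 0.
  have d0 : d 0 = 0.
    by have := der_linear d (-1) 0 0; rewrite scaleN1r addNr => ->; rewrite scaleN1r addNr.
  have d1 : d 1 = 0.
    have H : d 1 = d 1 + d 1 by have := der_leibniz d 1 1; rewrite !mul1r.
    by apply: (addrI (d 1)); rewrite addr0 -H.
  have := der_linear d c 1 0.
  by rewrite addr0 d0 d1 scaler0 addr0 -mul_mpolyC mulr1.
have derD (d : derivation R) u v : d (u + v) = d u + d v.
  by have := der_linear d 1 u v; rewrite !scale1r.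
elim/mpoly_ring_ind => [c|i|p q Ep Eq|p q Ep Eq] //.
- by rewrite !der1.
- by rewrite !derD Ep Eq.
- by rewrite !der_leibniz Ep Eq.
Qed.

Lemma field_derE (c : 'I_n -> R) p :
  (\sum_i c i *: partial k i : derivation R) p = \sum_i c i * p^`M(i).
Proof. by rewrite der_sumE. Qed.

Lemma field_der_var (c : 'I_n -> R) i :
  (\sum_l c l *: partial k l : derivation R) 'X_i = c i.
Proof.
rewrite field_derE (bigD1 i) //= mderivX1 eqxx mulr1 big1 ?addr0 // => l li.
by rewrite mderivX1 eq_sym (negPf li) mulr0.
Qed.

Lemma field_der_expand (th : derivation R) : th = \sum_i th 'X_i *: partial k i.
Proof. by apply: der_eq_vars => i; rewrite field_der_var. Qed.

End PolynomialDerivations.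

Lemma prod_homog (k : fieldType) n d (I : Type) (r : seq I)
    (F : I -> {mpoly k[n]}) :
  (forall i, F i \is d.-homog) -> \prod_(i <- r) F i \is (size r * d).-homog.
Proof.
move=> hF; elim: r => [|i r IHr]; first by rewrite big_nil dhomog1.
by rewrite big_cons mulSn; apply: dhomogM.
Qed.

Lemma det_homog (k : fieldType) n m d (A : 'M[{mpoly k[n]}]_m) :
  (forall i j, A i j \is d.-homog) -> \det A \is (m * d).-homog.
Proof.
move=> hA; apply: rpred_sum => s _; rewrite rpredMsign -big_enum.
have := @prod_homog k n d _ (enum 'I_m) (fun i => A i (perm.fun_of_perm s i)) (fun i => hA _ _).
by rewrite size_enum_ord.
Qed.

Lemma adjugate_homog (k : fieldType) n m d (A : 'M[{mpoly k[n]}]_m.+1) i j :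
  (forall i j, A i j \is d.-homog) -> \adj A i j \is (m * d).-homog.
Proof.
move=> hA; rewrite mxE /cofactor rpredMsign; apply: (@det_homog _ _ m) => a b.
by rewrite !mxE.
Qed.

Lemma lin_field_homog (k : fieldType) (C : 'M[k]_3) i : lin_field C i \is 1.-homog.
Proof.
apply: rpred_sum => l _; apply: dhomogZ.
by rewrite dhomogX /= mdeg1.
Qed.

(** Compare the components of degree 1 in the T_i: a syzygy that is a combination of
    Rees equations is a combination of their syzygies with coefficients in A. *)
Lemma linear_form_comb (A : comNzRingType) n (p q : {mpoly A[n]})
    (h c d : 'I_n -> A) :
  \sum_l h l *: 'X_l = p * \sum_l c l *: 'X_l + q * \sum_l d l *: 'X_l ->
  forall i, h i = p.@[fun=> 0] * c i + q.@[fun=> 0] * d i.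
Proof.
move=> E i; pose form (c : 'I_n -> A) : {mpoly A[n]} := \sum_l c l *: 'X_l.
have E0 c' : (form c').@[fun=> 0] = 0.
  by rewrite /form raddf_sum big1 // => l _; rewrite /= mevalZ mevalXU mulr0.
have E1 c' : (form c')^`M(i) = (c' i)%:MP.
  rewrite /form raddf_sum (bigD1 i) //= mderivZ mderivX1 eqxx big1 => [|l li].
    by rewrite addr0 alg_mpolyC.
  by rewrite mderivZ mderivX1 (negPf li) scaler0.
have := congr1 (fun q : {mpoly A[n]} => q^`M(i).@[fun=> 0]) E.
rewrite -!/(form _) mderivD !mderivM !E1 !(mevalD, mevalM) !E0 !mevalC.
by rewrite !mulr0 !add0r.
Qed.

Section KrylovDerivations.
Local Open Scope quotient_scope.
Variables (k : fieldType) (C : 'M[k]_3) (e : k).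
Hypothesis char_k : [pchar k] =i pred0.
Let f : {mpoly k[3]} := e *: \det (krylov C).
Hypothesis f0 : f != 0.
Hypothesis red_f : reduced f.

Local Notation R := {mpoly k[3]}.
Local Notation g := (fun i => f^`M(i)).

Let e0 : e != 0.
Proof. by apply: contraNneq f0 => e0; rewrite /f e0 scale0r. Qed.

Let det0 : \det (krylov C) != 0.
Proof. by apply: contraNneq f0 => det0; rewrite /f det0 scaler0. Qed.

Let D (j : 'I_3) : 'M[k]_3 := [:: 1%:M; C; C *m C]`_j.

Let krylovE i j : krylov C i j = lin_field (D j) i.
Proof. by rewrite mxE; elim/ord3P: j; rewrite //= /D /= lin_field1. Qed.

Definition lin_der (B : 'M[k]_3) : derivation R :=
  \sum_i lin_field B i *: partial k i.

Lemma lin_der_tder j : tder f (lin_der (D j)).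
Proof.
have [eig _ _ _] := krylov_cubic_facts char_k f0 red_f.
apply/principalP; exists (\tr (D j))%:MP.
rewrite /lin_der field_derE eig ?mul_mpolyC //.
by elim/ord3P: j; rewrite /D /= !inE eqxx ?orbT.
Qed.

Definition lin_tder j : sub_lmod (tder f) :=
  SubLmod (introT (asboolP _) (lin_der_tder j)).

Lemma lin_field_traceless (B : 'M[k]_3) i : lin_field (traceless B) i =
  lin_field B i - (\tr B / 3%:R) *: 'X_i.
Proof.
by rewrite lin_fieldD -scaleN1r lin_fieldZ -scalemx1 lin_fieldZ lin_field1 scaleN1r.
Qed.

(** If th f = u f, subtract u / 3 times the Euler field v to get a syzygy of the
    partial derivatives; this is the degree 1 part of the Rees equations, hence a
    combination of the traceless parts of C v and C^2 v. *)
Lemma tder_lin_generated (th : derivation R) : tder f th ->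
  exists v : 'rV[R]_3, th = \sum_j v 0 j *: lin_der (D j).
Proof.
have [eig _ ker _] := krylov_cubic_facts char_k f0 red_f.
have n3 := three_neq0 char_k.
move=> /principalP[u Eu].
pose a := 3%:R^-1 *: u.
pose h i := th 'X_i - a * 'X_i.
have h0 : \sum_i h i * f^`M(i) = 0.
  under eq_bigr => i _ do rewrite mulrBl.
  rewrite sumrB -field_derE -field_der_expand Eu.
  under eq_bigr => i _ do rewrite -mulrA.
  rewrite -mulr_sumr; have := eig 1%:M; rewrite mem_head mxtrace1 => /(_ isT).
  under eq_bigr => i _ do rewrite lin_field1.
  move=> ->; have -> : a * (3%:R *: f) = u * f.
    by rewrite /a -scalerAl -scalerAr scalerA mulVf // scale1r.
  by rewrite subrr.
have [|p [q Epq]] := ker (\sum_i h i *: 'X_i).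
  by rewrite rees_eval_form h0 scale0r.
pose b := p.@[fun=> 0]; pose c := q.@[fun=> 0].
have hE i : h i = b * lin_field (traceless C) i +
    c * lin_field (traceless (C *m C)) i.
  exact: (linear_form_comb Epq).
(* v0 collects the multiples of the Euler field hidden in the traceless parts *)
pose v0 := a - b * (\tr C / 3%:R)%:MP - c * (\tr (C *m C) / 3%:R)%:MP.
pose v : 'rV[R]_3 := \row_j [:: v0; b; c]`_j.
have [V0 V1 V2] : [/\ v 0 0 = v0, v 0 1 = b & v 0 2 = c].
  by split; rewrite mxE.
exists v; apply: der_eq_vars => i.
have linE j : (v 0 j *: lin_der (D j)) 'X_i = v 0 j * lin_field (D j) i.
  by rewrite der_scaleE /lin_der field_der_var.
have -> : (\sum_j v 0 j *: lin_der (D j)) 'X_i =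
    v0 * 'X_i + b * lin_field C i + c * lin_field (C *m C) i.
  rewrite der_sumE (eq_bigr _ (fun j _ => linE j)) sum_ord3 V0 V1 V2.
  by rewrite lin_field1.
have -> : th 'X_i = h i + a * 'X_i by rewrite subrK.
rewrite hE !lin_field_traceless -!mul_mpolyC /v0; ring.
Qed.

Local Notation E := (der_quotient f).
Local Notation S := (krylov C)^T.

Definition krylov_aug (j : 'I_3) : E := \pi_E (lin_tder j).

Lemma krylov_aug_sum (v : 'rV[R]_3) :
  \sum_j v 0 j *: krylov_aug j = \pi_E (\sum_j v 0 j *: lin_tder j).
Proof. by rewrite quot_lmod_pi_sum. Qed.

Lemma lin_tder_sumE (v : 'rV[R]_3) :
  val (\sum_j v 0 j *: lin_tder j) = \sum_j v 0 j *: lin_der (D j).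
Proof. by rewrite raddf_sum. Qed.

Lemma lin_tder_sum_var (v : 'rV[R]_3) i :
  (val (\sum_j v 0 j *: lin_tder j) : derivation R) 'X_i = (v *m S) 0 i.
Proof.
rewrite lin_tder_sumE der_sumE mxE; apply: eq_bigr => j _.
by rewrite der_scaleE /lin_der field_der_var mxE krylovE.
Qed.

Lemma krylov_aug_onto (x : E) : exists v : 'rV_3, x = \sum_j v 0 j *: krylov_aug j.
Proof.
elim/quotW: x => th; have [v Ev] := tder_lin_generated (sub_lmodP th).
exists v; rewrite krylov_aug_sum; congr (\pi_E _); apply: val_inj.
by rewrite Ev lin_tder_sumE.
Qed.

(** The coefficients of the generators v, C v, C^2 v form the matrix S, whose
    determinant is f up to a unit. Hence v S is divisible by f if and only if v is a
    combination of the rows of the adjugate of S. *)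
Lemma krylov_aug_kernel (v : 'rV[R]_3) :
  \sum_j v 0 j *: krylov_aug j = 0 <-> exists w, v = w *m \adj S.
Proof.
have detS : \det S = \det (krylov C) by rewrite det_tr.
have pi0 : \pi_E 0 = 0 :> E by rewrite -(scale0r 0) quot_lmod_piZ scale0r.
rewrite krylov_aug_sum -pi0; split=> [/eqP/quot_lmodP|[w Ew]].
  rewrite subr0 => -[eta Eeta].
  pose c : 'rV[R]_3 := \row_i eta 'X_i.
  have vS : v *m S = f *: c.
    by apply/rowP => i; rewrite -lin_tder_sum_var Eeta der_scaleE !mxE.
  exists (e%:MP *: c).
  have : (\det S) *: v = (\det S) *: ((e%:MP *: c) *m \adj S).
    rewrite -mul_mx_scalar -mul_mx_adj mulmxA vS -!scalemxAl scalerA.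
    by congr (_ *: _); rewrite /f detS -mul_mpolyC mulrC.
  move/rowP => H; apply/rowP => i; have := H i; rewrite [LHS]mxE [RHS]mxE.
  by apply: mulfI; rewrite detS.
apply/eqP/quot_lmodP; rewrite subr0.
exists (\sum_i (e^-1 *: w 0 i) *: partial k i).
apply: der_eq_vars => i; rewrite lin_tder_sum_var der_scaleE field_der_var.
rewrite Ew -mulmxA mul_adj_mx mul_mx_scalar mxE detS /f.
by rewrite -scalerAl -scalerAr scalerA mulfV // scale1r.
Qed.

Lemma adj_krylov_free (v : 'rV[R]_3) : v *m \adj S = 0 -> v = 0.
Proof.
move=> v0; have : v *m \adj S *m S = 0 by rewrite v0 mul0mx.
rewrite -mulmxA mul_adj_mx det_tr mul_mx_scalar => H.
apply/rowP => i; rewrite [RHS]mxE; have := congr1 (fun r : 'rV_3 => r 0 i) H.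
by rewrite !mxE => /eqP; rewrite mulf_eq0 (negPf det0) => /eqP.
Qed.

Definition krylov_rank (i : nat) : nat := if i is i'.+2 then 0 else 3.

Definition krylov_shift i (_ : 'I_(krylov_rank i)) : int :=
  if i is 0%N then 0 else 2.

Definition krylov_map i : 'M[R]_(krylov_rank i.+1, krylov_rank i) :=
  if i is 0%N then \adj S else 0.

Lemma krylov_tr_homog i j : S i j \is 1.-homog.
Proof. by rewrite mxE krylovE lin_field_homog. Qed.

Lemma krylov_adj_homog i j : \adj S i j \is 2.-homog.
Proof. by have := adjugate_homog i j krylov_tr_homog; rewrite muln1. Qed.

(** The resolution is 0 -> R(-2)^3 -> R^3: the generators have linear coefficients,
    that is degree 0, and the entries of the adjugate are quadratic. *)
Lemma krylov_regularity : is_regularity (@der_quotient_homog k 3 f) 1.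
Proof.
unshelve eexists; first (unshelve eapply (@MinGradedRes _ _ _ _ krylov_rank
  krylov_shift krylov_map krylov_aug)).
- move=> j; exists (lin_tder j) => //; exists (lin_field (D j)) => // i.
  exact: lin_field_homog.
- move=> [|i] r c; last by case: r.
  exact: krylov_adj_homog.
- exact: krylov_aug_onto.
- exact: krylov_aug_kernel.
- move=> [|i] v; last by split=> _; [exists 0|]; rewrite [v]thinmx0 ?mul0mx.
  split=> [/adj_krylov_free->|[w ->]]; first by exists 0; rewrite mul0mx.
  by rewrite mulmx0 mul0mx.
- move=> [|i] r c; last by case: r.
  by apply: (dhomog_nemf_coeff (krylov_adj_homog r c)); rewrite /= mdeg0.
split; first by exists 1%N, (0 : 'I_3).
by move=> [|[|i]] j //=; case: j.
Qed.

End KrylovDerivations.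

(** * The Jacobian ideal *)

Lemma rmorph_comb0 (A B : nzRingType) (F : {rmorphism A -> B}) a b u v :
  F a = 0 -> F b = 0 -> F (u * a + v * b) = 0.
Proof. by move=> Fa Fb; rewrite rmorphD !rmorphM /= Fa Fb !mulr0 addr0. Qed.

Lemma mderiv_lin_field (k : fieldType) (C : 'M[k]_3) i j :
  (lin_field C i)^`M(j) = (C i j)%:MP.
Proof.
rewrite /lin_field raddf_sum (bigD1 j) //= mderivZ mderivX1 eqxx big1 => [|l lj].
  by rewrite addr0 alg_mpolyC.
by rewrite mderivZ mderivX1 (negPf lj) scaler0.
Qed.

(** As the L_i are linear, differentiating the minors of v and C v brings in the
    entries of C, and C v combines with them to C^2 v. *)
Lemma jacobian_det_minors (k : fieldType) (C : 'M[k]_3) :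
  let v (i : 'I_3) : {mpoly k[3]} := 'X_i in
  let L := lin_field C in
  \det (\matrix_(i < 3, j < 3) ([:: v 0 * L 1 - v 1 * L 0;
    v 0 * L 2 - v 2 * L 0; v 1 * L 2 - v 2 * L 1]`_j)^`M(i)) =
  - 2%:R *: \det (krylov C).
Proof.
move=> v L.
have LM i : lin_field (C *m C) i = \sum_l C i l *: L l.
  transitivity (\sum_l (row i C *m C) 0 l *: 'X_l : {mpoly k[3]}).
    by apply: eq_bigr => l _; rewrite -row_mul [in RHS]mxE.
  by rewrite -lin_field_row; apply: eq_bigr => l _; rewrite mxE.
rewrite [LHS]det_mx33 !mxE /= /v /L !(mderivB, mderivM, mderiv_lin_field, mderivX1) /=.
rewrite det_mx33 ![krylov C _ _]mxE /= !LM !sum_ord3 -/L -!mul_mpolyC.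
rewrite mpolyCN mpolyC_nat.
have LE i : L i = (C i 0)%:MP * 'X_0 + (C i 1)%:MP * 'X_1 + (C i 2)%:MP * 'X_2.
  by rewrite /L /lin_field sum_ord3 -!mul_mpolyC.
rewrite !LE; ring.
Qed.

Section KrylovJacobian.
Variables (k : fieldType) (C : 'M[k]_3) (e : k).
Hypothesis char_k : [pchar k] =i pred0.
Let f : {mpoly k[3]} := e *: \det (krylov C).
Hypothesis f0 : f != 0.
Hypothesis red_f : reduced f.

Local Notation R := {mpoly k[3]}.
Local Notation g := (fun i => f^`M(i)).
Local Notation l1 := (lin_relation (traceless C)).
Local Notation l2 := (lin_relation (traceless (C *m C))).

Let linear_relation_of (B : 'M[k]_3) :
  rees_eval g (lin_relation B) = 0 -> linear_relation g (lin_relation B).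
Proof.
rewrite rees_eval_form => /(congr1 (fun q : {poly R} => q`_1)).
by rewrite coefZ coefX mulr1 coef0; exists (lin_field B).
Qed.

Lemma krylov_relations_linear : relations_linear g.
Proof.
have [_ [k1 k2] ker _] := krylov_cubic_facts char_k f0 red_f.
move=> p /ker[u [v ->]]; apply: idealD; apply: idealMl; apply: ideal_of_mem.
  exact: (linear_relation_of k1).
exact: (linear_relation_of k2).
Qed.

(** Otherwise C v would be proportional to v, and f would vanish. *)
Lemma krylov_relation_neq0 : l1 != 0.
Proof.
apply: contraNneq f0 => l10; rewrite /f.
have E i : lin_field C i = (\tr C / 3%:R)%:MP * 'X_i.
  have H : \sum_l lin_field (traceless C) l *: 'X_l =
      0 * (\sum_l (0 : R) *: 'X_l) + 0 * (\sum_l (0 : R) *: 'X_l) :> {mpoly R[3]}.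
    by rewrite -/l1 l10 !mul0r addr0.
  have := linear_form_comb H i; rewrite !mulr0 addr0 lin_field_traceless.
  by move/eqP; rewrite subr_eq0 mul_mpolyC => /eqP.
suff -> : \det (krylov C) = 0 by rewrite scaler0.
by rewrite det_mx33 !mxE /= !E; ring.
Qed.

Lemma krylov_complete_intersection :
  complete_intersection (Rees (jacobian_ideal f)).
Proof.
have [_ [k1 k2] ker syz] := krylov_cubic_facts char_k f0 red_f.
have ker2 u v : rees_eval g (u * l1 + v * l2) = 0.
  exact: (rmorph_comb0 (F := rees_eval g) u v k1 k2).
have reg : GRing.lreg l1 by exact: (mpoly_lreg krylov_relation_neq0).
apply: (complete_intersection_mpoly (s := [:: l1; l2]) (phi := rees_map g)).
- split.
    move=> /ideal_of2P[u [v E1]].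
    have /eqP : rees_eval g 1 = 0 by rewrite E1; exact: ker2.
    by rewrite [rees_eval g 1](rmorph1 (rees_eval g)) oner_eq0.
  move=> [|[|//]] x _.
    move=> /ideal_of0 l1x0; have -> : x = 0.
      by apply: reg; rewrite mulr0.
    exact: (ideal0 (ideal_of _)).
  move=> /ideal_of1P[u]; rewrite mulrC => /syz[v ->].
  by apply/ideal_of1P; exists v.
- exact: rees_map_onto.
move=> p; rewrite rees_map_eq0; split=> [/ker|] H; first exact/ideal_of2P.
by have /ideal_of2P[u [v ->]] := H; apply: ker2.
Qed.

End KrylovJacobian.

Theorem proposition5p3 (k : fieldType) (char_k : [pchar k] =i pred0)
    (a1 a2 a3 a4 a5 a6 a7 a8 a9 : k) :
  let x : {mpoly k[3]} := 'X_0 in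
  let y : {mpoly k[3]} := 'X_1 in
  let z : {mpoly k[3]} := 'X_2 in
  let L1 := a1 *: x + a2 *: y + a3 *: z in
  let L2 := a4 *: x + a5 *: y + a6 *: z in
  let L3 := a7 *: x + a8 *: y + a9 *: z in
  let Q1 := x * L2 - y * L1 in
  let Q2 := x * L3 - z * L1 in
  let Q3 := y * L3 - z * L2 in
  let Theta : 'M[{mpoly k[3]}]_3 :=
    \matrix_(i, j) ([:: Q1; Q2; Q3]`_j)^`M(i) in
  let f := \det Theta in
  [|| Q1 != 0, Q2 != 0 | Q3 != 0] ->
  f != 0 ->
  reduced f ->
  partials_free f ->
  let J := jacobian_ideal f in
  [/\ linear_type J /\ is_reduction_number J 0,
      complete_intersection (Rees J) &
      is_regularity (@der_quotient_homog k 3 f) 1].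
Proof.
move=> x y z L1 L2 L3 Q1 Q2 Q3 Theta f _ f0 red_f _ J.
pose C : 'M[k]_3 := \matrix_(i, j)
  (nth [::] [:: [:: a1; a2; a3]; [:: a4; a5; a6]; [:: a7; a8; a9]] i)`_j.
have fE : f = (- 2%:R) *: \det (krylov C).
  have [E1 E2 E3] : [/\ L1 = lin_field C 0, L2 = lin_field C 1 & L3 = lin_field C 2].
    by split; rewrite /lin_field sum_ord3 !mxE.
  by rewrite -jacobian_det_minors /f /Theta /Q1 /Q2 /Q3 E1 E2 E3.
move: @J; rewrite fE in f0 red_f *.
have lin := krylov_relations_linear char_k f0 red_f.
split; [split | |].
- exact: relations_linear_linear_type.
- exact: relations_linear_reduction_number.
- exact: krylov_complete_intersection.
- exact: krylov_regularity.
Qed.
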